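(* Let $d,n\in\mathbb{N}$ with $d<n$, let $E\in\mathrm{Reg}_d(C)$ be a $d$-regular subset of $\mathbb{R}^n$, and let $\Delta$ be a system of dyadic cubes for $E$. Then for all $q\in[1,\infty)$ and all $Q\in\Delta$, $$\beta_{q,\mathcal{V}_d}(2Q)^2\le\beta_{2q,\mathcal{V}_d}(2Q)^2\le\tilde C\,\iota_{q,d,\mathsf{Eucl}}(2Q)\le\tilde C\,\iota_{q,\mathcal{V}_d}(2Q),$$ where $\tilde C$ is a constant depending only on $d$, $q$ and $C$.
   Context: $\mathbb{R}^n$ carries the Euclidean distance. Regular sets: a closed set $E$ with $\mathrm{diam}(E)>0$ is in $\mathrm{Reg}_d(C)$, $C\ge1$, if $C^{-1}r^d\le\mathcal{H}^d(B_r(x)\cap E)\le Cr^d$ for all $x\in E$, $r\in(0,2\,\mathrm{diam}(E))$ ($B_r(x)$ open ball, $\mathcal{H}^d$ Hausdorff measure, $\mathrm{diam}(E)=+\infty$ if $E$ unbounded). Put $\mu=\mathcal{H}^d|_E$. Dyadic systems: if $E$ is bounded let $\mathbb{J}=\{j\in\mathbb{Z}:j\ge j_*\}$ where $2^{-j_*}\le\mathrm{diam}(E)<2^{-j_*+1}$; otherwise $\mathbb{J}=\mathbb{Z}$. It is known that there is $c_0=c_0(d,C)\in(0,1)$ such that every $E\in\mathrm{Reg}_d(C)$ admits a system of dyadic cubes $\Delta=\bigcup_{j\in\mathbb{J}}\Delta_j$, where each $\Delta_j$ is a family of pairwise disjoint Borel subsets of $E$ (cubes) such that: (1) $E=\bigcup_{Q\in\Delta_j}Q$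 for each $j$; (2) if $i\le j$, $Q\in\Delta_i$, $Q'\in\Delta_j$, then $Q'\subset Q$ or $Q\cap Q'=\emptyset$; (3) for $Q'\in\Delta_j$ and $i<j$, $i\in\mathbb{J}$, there is a unique $Q\in\Delta_i$ with $Q'\subset Q$; (4) $\mathrm{diam}(Q)\le c_0^{-1}2^{-j}$ for $Q\in\Delta_j$; (5) for each $Q\in\Delta_j$ there is $x_Q\in E$ with $B_{c_02^{-j}}(x_Q)\cap E\subset Q$. For $K>1$, $KQ=\{x\in E:\mathrm{dist}(x,Q)\le(K-1)\mathrm{diam}(Q)\}$. Coefficients: $\mathcal{V}_d$ is the family of $d$-dimensional affine planes in $\mathbb{R}^n$, $\pi_V:\mathbb{R}^n\to V$ the orthogonal projection. For $q\in[1,\infty)$ and $S\subset E$ bounded Borel with $\mu(S)>0$, $$\beta_{q,\mathcal{V}_d}(S)=\inf_{V\in\mathcal{V}_d}\Big(\frac1{\mu(S)}\int_S\Big[\frac{\mathrm{dist}(x,V)}{\mathrm{diam}(S)}\Big]^qd\mu(x)\Big)^{1/q},$$ $$\iota_{q,\mathcal{V}_d}(S)=\inf_{V\in\mathcal{V}_d}\Big(\frac1{\mu(S)^2}\int_S\int_S\Big[\frac{\big||x-y|-|\pi_V(x)-\pi_V(y)|\big|}{\mathrm{diam}(S)}\Big]^qd\mu(x)d\mu(y)\Big)^{1/q},$$ $$\iota_{q,d,\mathsf{Eucl}}(S)=\inf_{f}\Big(\frac1{\mu(S)^2}\int_S\int_S\Big[\frac{\big||x-y|-|f(x)-f(y)|\big|}{\mathrm{diam}(S)}\Big]^qd\mu(x)d\mu(y)\Big)^{1/q},$$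 the last infimum being over all Borel maps $f:S\to\mathbb{R}^d$, with $|\cdot|$ the Euclidean norm. *)

(* Defs.v *)
From HB Require Import structures.
From mathcomp Require Import all_boot all_order all_algebra.
From mathcomp Require Import all_classical all_reals all_analysis.

Set Implicit Arguments.
Unset Strict Implicit.
Unset Printing Implicit Defensive.

Import Order.TTheory GRing.Theory Num.Theory.
Import numFieldNormedType.Exports.

Local Open Scope classical_set_scope.
Local Open Scope ring_scope.

Section euclidean_space.
Context {R : realType}.

(* The library norm, balls and diameters on ['rV_n] are those of the max norm;
   hence the Euclidean versions below.  The topology of ['rV_n] is the product
   topology, which is the Euclidean one. *)
Definition edot n (u v : 'rV[R]_n) : R := \sum_(i < n) u 0 i * v 0 i.

Definition enorm n (u : 'rV[R]_n) : R := Num.sqrt (edot u u).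

Definition eball n (x : 'rV[R]_n) (r : R) : set 'rV[R]_n :=
  [set y | enorm (y - x) < r].

(* [0] is added so that the diameter of [set0] is [0] rather than [-oo]. *)
Definition ediam n (A : set 'rV[R]_n) : \bar R :=
  ereal_sup ([set 0%E] `|`
    [set (enorm (p.1 - p.2))%:E | p in A `*` A]).

(* Meaningful for nonempty [A] only. *)
Definition set_dist n (x : 'rV[R]_n) (A : set 'rV[R]_n) : R :=
  inf [set enorm (x - y) | y in A].

End euclidean_space.

(* ['rV_n] with its Borel sigma-algebra. *)
Definition borel (R : realType) (n : nat) :=
  g_sigma_algebraType (@open 'rV[R]_n).

Section hausdorff.
Context {R : realType}.
Local Open Scope ereal_scope.

(* The empty set contributes [0] even when [d = 0]. *)
Definition diam_pow n (d : nat) (U : set 'rV[R]_n) : \bar R :=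
  if U == set0 then 0 else ediam U ^+ d.

Definition hausdorff_pre n (d : nat) (delta : R) (A : set 'rV[R]_n) : \bar R :=
  ereal_inf [set \sum_(0 <= k <oo) diam_pow d (U k) | U in
    [set U : nat -> set 'rV[R]_n |
      A `<=` \bigcup_k U k /\ forall k, ediam (U k) <= delta%:E]].

(* No multiplicative normalisation (such as vol(B^d) / 2^d): a factor depending
   only on [d] changes the regularity constant by a factor depending only on
   [d], and cancels in the averages defining the coefficients. *)
Definition hausdorff n (d : nat) (A : set 'rV[R]_n) : \bar R :=
  ereal_sup [set hausdorff_pre d delta A | delta in [set delta : R | (0 < delta)%R]].

Definition hausdorff_restr n (d : nat) (E : set 'rV[R]_n) :
    set (borel R n) -> \bar R :=
  fun A => hausdorff d (A `&` E).

Definition regular n (d : nat) (C : R) (E : set 'rV[R]_n) : Prop :=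
  [/\ closed E, 0 < ediam E &
   forall (x : 'rV[R]_n) (r : R), E x -> (0 < r)%R -> r%:E < 2%:E * ediam E ->
     (C^-1 * r ^+ d)%:E <= hausdorff d (eball x r `&` E) <= (C * r ^+ d)%:E].

End hausdorff.

Section dyadic_cubes.
Context {R : realType}.

(* The index set of the generations of cubes; for bounded [E] with positive
   diameter the integer [j0] is unique. *)
Definition scales n (E : set 'rV[R]_n) : set int :=
  [set j | ediam E = +oo%E \/
    exists2 j0 : int,
      (((2 : R) ^ (- j0))%:E <= ediam E < ((2 : R) ^ (- j0 + 1))%:E)%E
      & j0 <= j].

Record dyadic_system n (E : set 'rV[R]_n) (c0 : R)
    (Delta : int -> set (set 'rV[R]_n)) : Prop := DyadicSystem {
  dyadic_borel : forall j Q, scales E j -> Delta j Q ->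
    measurable (Q : set (borel R n)) /\ Q `<=` E ;
  dyadic_disjoint : forall j, scales E j -> trivIset (Delta j) id ;
  dyadic_cover : forall j, scales E j -> E = \bigcup_(Q in Delta j) Q ;
  dyadic_nested : forall i j Q Q', scales E i -> scales E j -> i <= j ->
    Delta i Q -> Delta j Q' -> Q' `<=` Q \/ Q `&` Q' = set0 ;
  dyadic_parent : forall i j Q', scales E i -> scales E j -> i < j ->
    Delta j Q' -> exists! Q, Delta i Q /\ Q' `<=` Q ;
  dyadic_diam : forall j Q, scales E j -> Delta j Q ->
    (ediam Q <= (c0^-1 * 2 ^ (- j))%:E)%E ;
  dyadic_ball : forall j Q, scales E j -> Delta j Q ->
    exists2 x, E x & eball x (c0 * 2 ^ (- j)) `&` E `<=` Q }.

Definition dilation n (E : set 'rV[R]_n) (K : R) (Q : set 'rV[R]_n) :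
    set 'rV[R]_n :=
  [set x | E x /\ ((set_dist x Q)%:E <= (K - 1)%:E * ediam Q)%E].

End dyadic_cubes.

Section coefficients.
Context {R : realType}.

Definition affine_planes n (d : nat) : set (set 'rV[R]_n) :=
  [set V | exists (p : 'rV[R]_n) (A : 'M[R]_n),
    \rank A = d /\ V = [set x | (x - p <= A)%MS]].

(* When [V] is an affine plane there is exactly one such point, which [get]
   returns. *)
Definition orth_proj n (V : set 'rV[R]_n) (x : 'rV[R]_n) : 'rV[R]_n :=
  get [set y | V y /\ forall v, V v -> edot (x - y) (v - y) = 0].

Local Open Scope ereal_scope.

Definition beta_planes n (mu : set (borel R n) -> \bar R) (d : nat) (q : R)
    (S : set (borel R n)) : \bar R :=
  ereal_inf [set
    ((mu S)^-1 *
      \int[mu]_(x in S) ((set_dist x V / fine (ediam S)) `^ q)%:E) `^ q^-1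
    | V in affine_planes d].

Definition distortion n m (mu : set (borel R n) -> \bar R) (q : R)
    (S : set (borel R n)) (f : 'rV[R]_n -> 'rV[R]_m) : \bar R :=
  ((mu S ^+ 2)^-1 *
    \int[mu]_(x in S) \int[mu]_(y in S)
      ((`| enorm (x - y) - enorm (f x - f y) | / fine (ediam S)) `^ q)%:E)
  `^ q^-1.

Definition iota_planes n (mu : set (borel R n) -> \bar R) (d : nat) (q : R)
    (S : set (borel R n)) : \bar R :=
  ereal_inf [set distortion mu q S (orth_proj V) | V in affine_planes d].

(* [measurable_fun S f] only constrains [f] on [S], and the distortion only
   depends on [f] on [S]. *)
Definition iota_eucl n (mu : set (borel R n) -> \bar R) (d : nat) (q : R)
    (S : set (borel R n)) : \bar R :=
  ereal_inf [set distortion mu q S f | f in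
    [set f : borel R n -> borel R d | measurable_fun S f]].

End coefficients.

(* Main.v *)
(* Given a Borel map f : S -> R^d of small distortion on S = 2Q, choose points
   x_0, ..., x_d of S, one after the other, such that x_k stays at distance at
   least delta * diam S from the affine span of its predecessors, and such that
   the distortion of f is controlled by its average at the pairs (x_i, x_j) and,
   on average over y, at the pairs (x_i, y).  This is possible because by
   regularity the neighbourhood of a plane of dimension k < d carries a small
   proportion of the mass of S, while Markov's inequality bounds the other
   excluded sets.  For y in S, the d + 1 vectors f(x_i) - f(x_0), f(y) - f(x_0)
   of R^d are linearly dependent, and polarization shows that the Gram matrix of
   x_i - x_0, y - x_0 is close to theirs; hence the squared distance from y to
   the plane V through the x_i is at most a constant times diam S times the
   distortions involved.  Raising to the power q and averaging over y bounds
   beta_2q(2Q)^2.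

   Integrating requires the restricted Hausdorff measure to be a Borel measure,
   which follows from Caratheodory's criterion for metric outer measures.
   Coordinates in an orthonormal basis of V turn pi_V into a competitor for
   iota_eucl. *)
From HB Require Import structures.
Require Import Defs.
From mathcomp Require Import all_boot all_order all_algebra.
From mathcomp Require Import all_classical all_reals all_analysis.
From mathcomp Require Import measurable_realfun.
From mathcomp Require Import ring lra.
Import Order.TTheory GRing.Theory Num.Theory.
Import numFieldNormedType.Exports.
Local Open Scope classical_set_scope.
Local Open Scope ring_scope.

Set Implicit Arguments.
Unset Strict Implicit.
Unset Printing Implicit Defensive.

(** * Euclidean space *)

Section euclidean.
Context {R : realType}.
Implicit Types (n : nat).

Lemma edotE n (u v : 'rV[R]_n) : edot u v = (u *m v^T) 0 0.
Proof. by rewrite mxE; apply: eq_bigr => i _; rewrite mxE. Qed.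

Lemma edotC n (u v : 'rV[R]_n) : edot u v = edot v u.
Proof. by apply: eq_bigr => i _; rewrite mulrC. Qed.

Lemma edotDl n (u v w : 'rV[R]_n) : edot (u + v) w = edot u w + edot v w.
Proof. by rewrite !edotE mulmxDl mxE. Qed.

Lemma edotZl n a (u w : 'rV[R]_n) : edot (a *: u) w = a * edot u w.
Proof. by rewrite !edotE -scalemxAl mxE. Qed.

Lemma edotDr n (u v w : 'rV[R]_n) : edot w (u + v) = edot w u + edot w v.
Proof. by rewrite edotC edotDl !(edotC w). Qed.

Lemma edotZr n a (u w : 'rV[R]_n) : edot w (a *: u) = a * edot w u.
Proof. by rewrite edotC edotZl edotC. Qed.

Lemma edotNl n (u w : 'rV[R]_n) : edot (- u) w = - edot u w.
Proof. by rewrite -scaleN1r edotZl mulN1r. Qed.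

Lemma edotNr n (u w : 'rV[R]_n) : edot w (- u) = - edot w u.
Proof. by rewrite edotC edotNl edotC. Qed.

Lemma edotBl n (u v w : 'rV[R]_n) : edot (u - v) w = edot u w - edot v w.
Proof. by rewrite edotDl edotNl. Qed.

Lemma edotBr n (u v w : 'rV[R]_n) : edot w (u - v) = edot w u - edot w v.
Proof. by rewrite edotDr edotNr. Qed.

Lemma edot0l n (u : 'rV[R]_n) : edot 0 u = 0.
Proof. by rewrite -[0](scale0r 0) edotZl mul0r. Qed.

Lemma edot0r n (u : 'rV[R]_n) : edot u 0 = 0.
Proof. by rewrite edotC edot0l. Qed.

Lemma edot_suml n (I : finType) (F : I -> 'rV[R]_n) w :
  edot (\sum_i F i) w = \sum_i edot (F i) w.
Proof. by rewrite edotE mulmx_suml summxE; apply: eq_bigr => i; rewrite edotE. Qed.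

Lemma edot_sumr n (I : finType) (F : I -> 'rV[R]_n) w :
  edot w (\sum_i F i) = \sum_i edot w (F i).
Proof. by rewrite edotC edot_suml; apply: eq_bigr => i; rewrite edotC. Qed.

Lemma edot_ge0 n (u : 'rV[R]_n) : 0 <= edot u u.
Proof. by apply: sumr_ge0 => i _; rewrite -expr2 sqr_ge0. Qed.

Lemma edot_eq0 n (u : 'rV[R]_n) : edot u u = 0 -> u = 0.
Proof.
move=> /eqP; rewrite psumr_eq0; last by move=> i _; rewrite -expr2 sqr_ge0.
move=> /allP u0; apply/rowP => i; rewrite mxE.
by have := u0 i (mem_index_enum _); rewrite -expr2 sqrf_eq0 => /eqP.
Qed.

Lemma enorm_ge0 n (u : 'rV[R]_n) : 0 <= enorm u.
Proof. exact: sqrtr_ge0. Qed.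
Hint Resolve enorm_ge0 : core.

Lemma enorm_sqr n (u : 'rV[R]_n) : enorm u ^+ 2 = edot u u.
Proof. by rewrite sqr_sqrtr ?edot_ge0. Qed.

Lemma enorm0 n : enorm (0 : 'rV[R]_n) = 0.
Proof. by rewrite /enorm edot0l sqrtr0. Qed.

Lemma enorm_eq0 n (u : 'rV[R]_n) : enorm u = 0 -> u = 0.
Proof. by move=> u0; apply: edot_eq0; rewrite -enorm_sqr u0 expr0n. Qed.

Lemma enormZ n a (u : 'rV[R]_n) : enorm (a *: u) = `|a| * enorm u.
Proof.
apply/eqP; rewrite -(@eqrXn2 _ 2) ?mulr_ge0 //.
by rewrite exprMn !enorm_sqr edotZl edotZr mulrA real_normK ?num_real.
Qed.

Lemma enormN n (u : 'rV[R]_n) : enorm (- u) = enorm u.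
Proof. by rewrite -scaleN1r enormZ normrN1 mul1r. Qed.

Lemma enormBC n (u v : 'rV[R]_n) : enorm (u - v) = enorm (v - u).
Proof. by rewrite -enormN opprB. Qed.

(** Cauchy-Schwarz: expand the squared norm of [edot v v *: u - edot u v *: v] and divide by
    [edot v v]. *)
Lemma edot_le n (u v : 'rV[R]_n) : edot u v <= enorm u * enorm v.
Proof.
have [v0|vn0] := eqVneq (edot v v) 0.
  by rewrite (edot_eq0 v0) edot0r mulr_ge0.
have vp : 0 < edot v v by rewrite lt_def vn0 edot_ge0.
have := edot_ge0 (edot v v *: u - edot u v *: v).
rewrite edotBl !edotBr !edotZl !edotZr (edotC v u) => h.
have {}h : 0 <= edot v v * (edot u u * edot v v - edot u v ^+ 2) by lra.
rewrite pmulr_rge0 // subr_ge0 -!enorm_sqr -exprMn in h.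
apply: le_trans (ler_norm _) _.
by rewrite -(@ler_pXn2r _ 2) ?nnegrE ?mulr_ge0 // real_normK ?num_real.
Qed.

Lemma ler_enormD n (u v : 'rV[R]_n) : enorm (u + v) <= enorm u + enorm v.
Proof.
rewrite -(@ler_pXn2r _ 2) ?nnegrE ?addr_ge0 // enorm_sqr.
rewrite edotDl !edotDr (edotC v u) -!enorm_sqr.
by have := edot_le u v; nra.
Qed.

Lemma ler_enormB n (u v : 'rV[R]_n) : enorm (u - v) <= enorm u + enorm v.
Proof. by rewrite -(enormN v) ler_enormD. Qed.

Lemma ler_edistD n (w u v : 'rV[R]_n) :
  enorm (u - v) <= enorm (u - w) + enorm (w - v).
Proof. by rewrite -[u - v](subrKA w) ler_enormD. Qed.

Lemma lerB_enorm n (u v : 'rV[R]_n) : enorm u - enorm v <= enorm (u - v).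
Proof. by rewrite lerBlDr -{1}[u](subrK v) ler_enormD. Qed.

Lemma ler_enorm_sum n (I : finType) (F : I -> 'rV[R]_n) :
  enorm (\sum_i F i) <= \sum_i enorm (F i).
Proof.
elim/big_ind2 : _ => [|u a v b ua vb|//]; first by rewrite enorm0.
by apply: le_trans (ler_enormD _ _) _; rewrite lerD.
Qed.

Lemma ler_coord_enorm n (u : 'rV[R]_n) i : `|u 0 i| <= enorm u.
Proof.
rewrite -(@ler_pXn2r _ 2) ?nnegrE // enorm_sqr real_normK ?num_real //.
rewrite /edot (bigD1 i) //= -expr2 lerDl.
by apply: sumr_ge0 => j _; rewrite -expr2 sqr_ge0.
Qed.

Lemma ler_enorm_coord n (u : 'rV[R]_n) : enorm u <= \sum_i `|u 0 i|.
Proof.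
rewrite {1}[u]row_sum_delta; apply: le_trans (ler_enorm_sum _) _.
apply: ler_sum => i _; rewrite enormZ ler_piMr //.
rewrite -(@ler_pXn2r _ 2) ?nnegrE // enorm_sqr expr1n /edot (bigD1 i) //=.
rewrite big1 ?addr0 ?mxE ?eqxx ?mulr1 // => j /negPf ji.
by rewrite mxE ji andbF mul0r.
Qed.

Lemma eball_center n (x : 'rV[R]_n) r : 0 < r -> eball x r x.
Proof. by rewrite /eball /= subrr enorm0. Qed.

Lemma nbhs_eball n (x : 'rV[R]_n) r : 0 < r -> nbhs x (eball x r).
Proof.
move=> r0; rewrite nbhs_ballP.
(* Radius for the max norm: [n] coordinates, each at most [r / n.+1], add up to less than [r], also
   when [n = 0]. *)
exists (r / n.+1%:R); first by rewrite /= divr_gt0.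
move=> y [_ xy]; rewrite /eball /=.
apply: le_lt_trans (ler_enorm_coord _) _.
apply: (@le_lt_trans _ _ (\sum_(i < n) r / n.+1%:R)).
  apply: ler_sum => i _; rewrite !mxE distrC; apply: ltW; exact: xy.
rewrite sumr_const card_ord -[_ *+ n]mulr_natr -mulrA gtr_pMr // mulrC.
by rewrite ltr_pdivrMr // mul1r ltr_nat.
Qed.

Lemma nbhs_eballP n (x : 'rV[R]_n) (A : set 'rV[R]_n) :
  nbhs x A <-> exists2 r, 0 < r & eball x r `<=` A.
Proof.
split=> [|[r r0 rA]]; last exact: filterS rA (nbhs_eball _ r0).
rewrite nbhs_ballP => -[r /= r0 rA]; exists r => // y xy.
apply: rA; split => // i j; rewrite ord1 /ball /= distrC.
by have := ler_coord_enorm (y - x) j; rewrite !mxE => /le_lt_trans; apply.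
Qed.

Lemma open_eball n (x : 'rV[R]_n) r : open (eball x r).
Proof.
rewrite openE => y xy; apply/nbhs_eballP; exists (r - enorm (y - x)).
  by rewrite subr_gt0.
move=> z; rewrite /eball /= ltrBrDr => h.
by apply: le_lt_trans h; apply: ler_edistD.
Qed.

Lemma lipschitz_open_gt n (f : 'rV[R]_n -> R) K a : 0 < K ->
  (forall x y, `|f x - f y| <= K * enorm (x - y)) -> open [set x | a < f x].
Proof.
move=> K0 fK; rewrite openE => x /= ax; apply/nbhs_eballP.
exists ((f x - a) / K); first by rewrite divr_gt0 ?subr_gt0.
move=> y; rewrite /eball /= ltr_pdivlMr // => xy.
have := fK y x; have := ler_norm (f x - f y); rewrite distrC; lra.
Qed.

Lemma lipschitz_measurable n (f : 'rV[R]_n -> R) K : 0 < K ->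
  (forall x y, `|f x - f y| <= K * enorm (x - y)) ->
  measurable_fun [set: borel R n] (f : borel R n -> R).
Proof.
move=> K0 fK.
move=> mD; apply: (measurability _ (RGenOInfty.measurableE R)) => //.
move=> _ [_ [a ->] <-]; rewrite setTI; apply: sub_sigma_algebra.
have -> : f @^-1` `]a, +oo[ = [set x | a < f x].
  by apply/seteqP; split=> x /=; rewrite in_itv /= andbT.
exact: lipschitz_open_gt fK.
Qed.

Lemma set_dist_ge0 n (x : 'rV[R]_n) A : 0 <= set_dist x A.
Proof.
have [->|/set0P [a Aa]] := eqVneq A set0; first by rewrite /set_dist image_set0 inf0.
by apply: lb_le_inf => [|_ [y _ <-] //]; exists (enorm (x - a)); exists a.
Qed.

Lemma set_dist_le n (x y : 'rV[R]_n) A : A y -> set_dist x A <= enorm (x - y).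
Proof.
move=> Ay; apply: ge_inf; last by exists y.
by exists 0 => _ [z _ <-].
Qed.

Lemma set_dist_lt n (x : 'rV[R]_n) A e : A !=set0 -> set_dist x A < e ->
  exists2 y, A y & enorm (x - y) < e.
Proof.
move=> [a Aa] /inf_lt; case => [|_ [y Ay <-] ye]; last by exists y.
by exists (enorm (x - a)); exists a.
Qed.

Lemma set_dist_lipschitz n A (x y : 'rV[R]_n) :
  `|set_dist x A - set_dist y A| <= enorm (x - y).
Proof.
(* The infimum of the empty set is [0], so the distance to it is constant. *)
have [->|/set0P A0] := eqVneq A set0.
  by rewrite /set_dist !image_set0 inf0 subrr normr0.
suff h (u v : 'rV[R]_n) : set_dist u A - set_dist v A <= enorm (u - v).
  by rewrite ler_norml h andbT lerNl opprB enormBC h.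
apply/ler_addgt0Pr => e e0.
have [a Aa ae] : exists2 a, A a & enorm (v - a) < set_dist v A + e.
  by apply: set_dist_lt => //; rewrite ltrDl.
have := set_dist_le u Aa; have := ler_edistD v u a; lra.
Qed.

Lemma set_dist_measurable n (A : set 'rV[R]_n) :
  measurable_fun [set: borel R n] ((fun x => set_dist x A) : borel R n -> R).
Proof.
by apply: (@lipschitz_measurable _ _ 1) => // x y; rewrite mul1r set_dist_lipschitz.
Qed.

(** Writes a closed set as a sublevel set of a 1-Lipschitz function, the form in which
    Caratheodory's criterion is proved below. *)
Lemma closed_set_dist0 n (A : set 'rV[R]_n) : closed A -> A !=set0 ->
  A = [set x | set_dist x A <= 0].
Proof.
move=> cA A0; apply/seteqP; split => x.
  by move=> Ax /=; rewrite -(enorm0 n) -(subrr x) set_dist_le.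
move=> /= x0; apply: cA => B /nbhs_eballP [r r0 rB].
have [y Ay yr] : exists2 y, A y & enorm (x - y) < r.
  by apply: set_dist_lt => //; apply: le_lt_trans r0.
by exists y; split => //; apply: rB; rewrite /eball /= enormBC.
Qed.

Lemma open_measurable_borel n (A : set 'rV[R]_n) :
  open A -> measurable (A : set (borel R n)).
Proof. exact: sub_sigma_algebra. Qed.

Lemma closed_measurable_borel n (A : set 'rV[R]_n) :
  closed A -> measurable (A : set (borel R n)).
Proof.
move=> /closed_openC/open_measurable_borel oA.
by rewrite -(setCK A); apply: measurableC.
Qed.

Lemma eball_measurable n (x : 'rV[R]_n) r :
  measurable (eball x r : set (borel R n)).
Proof. by apply: open_measurable_borel; apply: open_eball. Qed.

Lemma ediam_ge0 n (A : set 'rV[R]_n) : (0 <= ediam A)%E.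
Proof. by apply: ereal_sup_ubound; left. Qed.

Lemma ediam_ge n (A : set 'rV[R]_n) x y : A x -> A y ->
  ((enorm (x - y))%:E <= ediam A)%E.
Proof. by move=> Ax Ay; apply: ereal_sup_ubound; right; exists (x, y). Qed.

Lemma ediam_le n (A : set 'rV[R]_n) (e : \bar R) : (0 <= e)%E ->
  (forall x y, A x -> A y -> ((enorm (x - y))%:E <= e)%E) -> (ediam A <= e)%E.
Proof.
move=> e0 Ae; apply: ge_ereal_sup => _ [->//|[[x y] /= [Ax Ay] <-]].
exact: Ae.
Qed.

Lemma le_ediam n (A B : set 'rV[R]_n) : A `<=` B -> (ediam A <= ediam B)%E.
Proof.
by move=> AB; apply: ediam_le (ediam_ge0 _) _ => x y /AB Ax /AB Ay; apply: ediam_ge.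
Qed.

End euclidean.
#[global] Hint Extern 0 (is_true (0 <= enorm _)) => solve [apply: enorm_ge0] : core.

(** * Hausdorff measure *)

Section hausdorff_outer.
Context {R : realType} (n d : nat).
Local Open Scope ereal_scope.
Implicit Types (A B U : set 'rV[R]_n).

Lemma diam_pow_ge0 U : 0 <= diam_pow d U.
Proof. by rewrite /diam_pow; case: ifPn => // _; rewrite expe_ge0 ?ediam_ge0. Qed.

Lemma diam_pow_set0 : diam_pow d (@set0 'rV[R]_n) = 0.
Proof. by rewrite /diam_pow eqxx. Qed.

Lemma ediam_set0 : ediam (@set0 'rV[R]_n) = 0.
Proof. by apply/eqP; rewrite eq_le ediam_ge0 andbT ediam_le. Qed.

Lemma hausdorff_pre_le_sum delta A (U : nat -> set 'rV[R]_n) :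
  A `<=` \bigcup_k U k -> (forall k, ediam (U k) <= delta%:E) ->
  hausdorff_pre d delta A <= \sum_(0 <= k <oo) diam_pow d (U k).
Proof. by move=> AU Ud; apply: ereal_inf_lbound; exists U. Qed.

Lemma hausdorff_pre_ge0 delta A : 0 <= hausdorff_pre d delta A.
Proof.
by apply: le_ereal_inf_tmp => _ [U _ <-]; apply: nneseries_ge0 => *; apply: diam_pow_ge0.
Qed.

Lemma hausdorff_pre_set0 (delta : R) : (0 <= delta)%R ->
  hausdorff_pre d delta (@set0 'rV[R]_n) = 0.
Proof.
move=> d0; apply/eqP; rewrite eq_le hausdorff_pre_ge0 andbT.
apply: le_trans (@hausdorff_pre_le_sum _ _ (fun=> set0) _ _) _ => //.
- by move=> k; rewrite ediam_set0 lee_fin.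
- by rewrite eseries0 // => *; exact: diam_pow_set0.
Qed.

Lemma le_hausdorff_pre delta A B : A `<=` B ->
  hausdorff_pre d delta A <= hausdorff_pre d delta B.
Proof.
move=> AB; apply: le_ereal_inf_tmp => _ [U [BU Ud] <-].
by apply: hausdorff_pre_le_sum => //; apply: subset_trans BU.
Qed.

Lemma hausdorff_pre_anti (delta delta' : R) A : (delta <= delta')%R ->
  hausdorff_pre d delta' A <= hausdorff_pre d delta A.
Proof.
move=> dd; apply: le_ereal_inf_tmp => _ [U [AU Ud] <-].
by apply: hausdorff_pre_le_sum => // k; apply: le_trans (Ud k) _; rewrite lee_fin.
Qed.

(** Here every set is measurable, so the measurable covers over which [mu_ext] takes its infimum are
    arbitrary covers. *)
Let discrete := g_sigma_algebraType [set: set 'rV[R]_n].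

(* Assigning [+oo] to the sets of large diameter turns the infimum over covers
   by small sets into the library's outer measure [mu_ext], over all covers. *)
Let gauge (delta : R) (U : set discrete) : \bar R :=
  if ediam (U : set 'rV[R]_n) <= delta%:E then diam_pow d (U : set 'rV[R]_n)
  else +oo.

Let gauge_ge0 delta U : 0 <= gauge delta U.
Proof. by rewrite /gauge; case: ifP => // _; exact: diam_pow_ge0. Qed.

Lemma hausdorff_pre_mu_ext (delta : R) : hausdorff_pre d delta = mu_ext (gauge delta).
Proof.
apply/funext => A; apply/eqP; rewrite eq_le; apply/andP; split.
  apply: le_ereal_inf_tmp => _ [U [_ AU] <-].
  (* A cover with one set of large diameter has infinite total gauge; any other cover is admissible
     for [hausdorff_pre]. *)
  have [[k Uk]|Ud] := pselect (exists k, ~ ediam (U k : set 'rV[R]_n) <= delta%:E).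
    rewrite (@eseries_pinfty _ _ _ k) ?leey //.
      by move=> m _; rewrite gt_eqF // (lt_le_trans _ (gauge_ge0 _ _)) ?ltNy0.
    by rewrite /gauge; case: ifP Uk.
  have {}Ud k : ediam (U k : set 'rV[R]_n) <= delta%:E.
    by apply: contrapT => h; apply: Ud; exists k.
  apply: le_trans (hausdorff_pre_le_sum AU Ud) _.
  by apply: lee_nneseries => [*|k _]; [exact: diam_pow_ge0|rewrite /gauge Ud].
apply: le_ereal_inf_tmp => _ [U [AU Ud] <-]; apply: ereal_inf_lbound.
exists U; first by split=> // k; apply: sub_sigma_algebra.
by apply: eq_eseriesr => k _; rewrite /gauge Ud.
Qed.

Lemma hausdorff_pre_sigma_subadditive delta :
  sigma_subadditive (@hausdorff_pre R n d delta).
Proof.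
rewrite hausdorff_pre_mu_ext.
exact: (@mu_ext_sigma_subadditive _ discrete R (gauge delta) (@gauge_ge0 delta)).
Qed.

Lemma hausdorff_pre_le (delta : R) A : (0 < delta)%R ->
  hausdorff_pre d delta A <= hausdorff d A.
Proof. by move=> d0; apply: ereal_sup_ubound; exists delta. Qed.

Lemma hausdorff0 : hausdorff d (@set0 'rV[R]_n) = 0.
Proof.
apply/eqP; rewrite eq_le; apply/andP; split.
  by apply: ge_ereal_sup => _ [e /= e0 <-]; rewrite hausdorff_pre_set0 // ltW.
by apply: le_trans (hausdorff_pre_le _ ltr01); exact: hausdorff_pre_ge0.
Qed.

Lemma hausdorff_ge0 A : 0 <= hausdorff d A.
Proof. by apply: le_trans (hausdorff_pre_le _ ltr01); exact: hausdorff_pre_ge0. Qed.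

Lemma le_hausdorff : {homo @hausdorff R n d : A B / A `<=` B >-> A <= B}.
Proof.
move=> A B AB; apply: ge_ereal_sup => _ [e /= e0 <-].
exact: le_trans (le_hausdorff_pre _ AB) (hausdorff_pre_le _ e0).
Qed.

Lemma hausdorff_sigma_subadditive : sigma_subadditive (@hausdorff R n d).
Proof.
move=> F; apply: ge_ereal_sup => _ [e /= e0 <-].
apply: le_trans (hausdorff_pre_sigma_subadditive _ _) _.
by apply: lee_nneseries => *; [exact: hausdorff_pre_ge0|exact: hausdorff_pre_le].
Qed.

HB.instance Definition _ := isOuterMeasure.Build R 'rV[R]_n (@hausdorff R n d)
  hausdorff0 hausdorff_ge0 le_hausdorff hausdorff_sigma_subadditive.

(** Serves to show that a cube, which has positive measure, is not a single point. *)
Lemma hausdorff_set1 (x : 'rV[R]_n) : (0 < d)%N -> hausdorff d [set x] = 0.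
Proof.
move=> d0; have dx : ediam [set x] = 0.
  apply/eqP; rewrite eq_le ediam_ge0 andbT ediam_le // => _ _ -> ->.
  by rewrite subrr enorm0.
apply/eqP; rewrite eq_le hausdorff_ge0 andbT.
apply: ge_ereal_sup => _ [e /= e0 <-].
apply: le_trans (@hausdorff_pre_le_sum _ _ (fun=> [set x]) _ _) _ => //.
- by move=> y ->; exists 0%N.
- by move=> k; rewrite dx lee_fin ltW.
- rewrite eseries0 // => k _ _; rewrite /diam_pow dx; case: ifP => // _.
  by case: d d0 => // m _; rewrite expeS mul0e.
Qed.

(** A set of diameter at most [delta < s] cannot meet both [A] and [B], so a cover of the union
    splits into a cover of [A] and one of [B] with no set used twice. *)
Lemma hausdorff_preU (A B : set 'rV[R]_n) (s delta : R) : (delta < s)%R ->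
  (forall x y, A x -> B y -> (s <= enorm (x - y))%R) ->
  hausdorff_pre d delta A + hausdorff_pre d delta B <=
  hausdorff_pre d delta (A `|` B).
Proof.
move=> ds AB; apply: le_ereal_inf_tmp => _ [U [ABU Ud] <-].
pose part Y k := if `[< U k `&` Y !=set0 >] then U k else set0.
have partP Y : Y `<=` A `|` B -> hausdorff_pre d delta Y <=
    \sum_(0 <= k <oo) diam_pow d (part Y k).
  move=> YAB; apply: hausdorff_pre_le_sum => [y Yy|k].
    have [k _ Uky] := ABU _ (YAB _ Yy); exists k => //.
    by rewrite /part asboolT //; exists y.
  rewrite /part; case: ifP => _ //.
  by rewrite ediam_set0; apply: le_trans (Ud k); exact: ediam_ge0.
apply: le_trans (leeD (partP A _) (partP B _)) _; [exact: subsetUl|exact: subsetUr|].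
rewrite -nneseriesD; [|by move=> *; exact: diam_pow_ge0..].
apply: lee_nneseries => [*|k _]; first by rewrite adde_ge0 ?diam_pow_ge0.
rewrite /part; case: asboolP => [[x [Ux Ax]]|_]; last first.
  by rewrite diam_pow_set0 add0e; case: ifP; rewrite ?diam_pow_set0 ?diam_pow_ge0.
case: asboolP => [[y [Uy By]]|_]; last by rewrite diam_pow_set0 adde0.
have := le_trans (ediam_ge Ux Uy) (Ud k).
by rewrite lee_fin => /le_lt_trans/(_ ds); rewrite ltNge AB.
Qed.

Lemma hausdorff_metric (A B : set 'rV[R]_n) (s : R) : (0 < s)%R ->
  (forall x y, A x -> B y -> (s <= enorm (x - y))%R) ->
  hausdorff d A + hausdorff d B <= hausdorff d (A `|` B).
Proof.
move=> s0 AB.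
have [->|foo] := eqVneq (hausdorff d (A `|` B)) +oo; first by rewrite leey.
have fin Y : Y `<=` A `|` B -> hausdorff d Y \is a fin_num.
  move=> /le_hausdorff YAB; rewrite ge0_fin_numE ?hausdorff_ge0 //.
  by apply: le_lt_trans YAB _; rewrite ltey.
have fA := fin A (@subsetUl _ _ _); have fB := fin B (@subsetUr _ _ _).
rewrite -leeBrDr //; apply: ge_ereal_sup => _ [e1 /= e10 <-].
have fe1 : hausdorff_pre d e1 A \is a fin_num.
  rewrite ge0_fin_numE ?hausdorff_pre_ge0 //.
  by apply: le_lt_trans (hausdorff_pre_le _ e10) _; rewrite -ge0_fin_numE // hausdorff_ge0.
rewrite leeBrDr // addeC -leeBrDr //; apply: ge_ereal_sup => _ [e2 /= e20 <-].
rewrite leeBrDr // addeC.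
(* The premeasures increase as the scale decreases, so one scale below [s], [e1] and [e2] serves
   both terms. *)
pose e : R := (Num.min (s / 2) (Num.min e1 e2))%R.
have e0 : (0 < e)%R by rewrite !lt_min e10 e20 divr_gt0.
have es : (e < s)%R by rewrite gt_min ltr_pdivrMr // ltr_pMr // ltr1n.
apply: le_trans (hausdorff_pre_le _ e0); apply: le_trans (hausdorff_preU es AB).
by apply: leeD; apply: hausdorff_pre_anti; rewrite !ge_min lexx !orbT.
Qed.

End hausdorff_outer.

(** * Caratheodory's criterion for sublevel sets of a 1-Lipschitz function *)

Section caratheodory_criterion.
Context {R : realType} (n d : nat).
Local Open Scope ereal_scope.
Variables (u : 'rV[R]_n -> R) (X : set 'rV[R]_n).
Hypothesis u_lip : forall x y, (`|u x - u y| <= enorm (x - y))%R.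
Hypothesis finX : hausdorff d X < +oo.

Let a (k : nat) : R := k.+1%:R^-1.
(** Since [a 0 = 1] and [a k] decreases to [0], the rings partition the part of [X] where
    [0 < u <= 1]. *)
Let ring_ (k : nat) := X `&` [set x | (a k.+1 < u x <= a k)%R].

Let a_gt0 k : (0 < a k)%R. Proof. by rewrite invr_gt0. Qed.

Let a_anti i j : (i <= j)%N -> (a j <= a i)%R.
Proof. by move=> ij; rewrite lef_pV2 ?posrE // ler_nat. Qed.

Let a_lt k : (a k.+1 < a k)%R.
Proof. by rewrite ltf_pV2 ?posrE // ltr_nat. Qed.

Let gap A B (b c : R) : (b < c)%R -> (forall x, A x -> (c <= u x)%R) ->
  (forall x, B x -> (u x <= b)%R) ->
  hausdorff d A + hausdorff d B <= hausdorff d (A `|` B).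
Proof.
move=> bc Ac Bb; apply: (@hausdorff_metric _ _ _ _ _ (c - b)).
  by rewrite subr_gt0.
move=> x y /Ac cx /Bb yb; apply: le_trans (u_lip _ _).
by apply: le_trans (ler_norm _); lra.
Qed.

(* Rings of the same parity are at positive distance from each other. *)
Let sum_rings_parity (p : bool) (N : nat) :
  \sum_(k < N | odd k == p) hausdorff d (ring_ k) <=
  hausdorff d (\bigcup_(k in [set k | (k < N)%N /\ odd k = p]) ring_ k).
Proof.
elim: N => [|N IH]; first by rewrite big_ord0 hausdorff_ge0.
rewrite big_mkcond big_ord_recr -big_mkcond /=; case: ifPn => [/eqP pN|_]; last first.
  rewrite adde0; apply: le_trans IH _; apply: le_hausdorff.
  by apply: bigcup_subset => k [kN kp]; split=> //; apply: ltnW.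
apply: (@le_trans _ _ (hausdorff d
    (\bigcup_(k in [set k | (k < N)%N /\ odd k = p]) ring_ k `|` ring_ N))); last first.
  apply: le_hausdorff => x [[k [kN kp] kx]|Nx].
    by exists k => //; split=> //; apply: ltnW.
  by exists N.
apply: le_trans (leeD IH (lexx _)) _.
case: N pN {IH} => [|N] pN.
  rewrite [X in hausdorff _ X + _](_ : _ = set0) ?hausdorff0 ?add0e.
    by apply: le_hausdorff; right.
  by rewrite bigcup0 // => k [].
apply: (gap (a_lt N)) => x; last by case=> _ /andP[].
case=> k [kN kp] [_ /andP[+ _]] => /ltW; apply: le_trans; apply: a_anti.
(* Parity excludes [k = N], so ring [k] lies above level [a N], while ring [N.+1] lies at or below
   [a N.+1]. *)
rewrite ltnS in kN; rewrite ltn_neqAle kN andbT.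
by apply: contra_eqN kp => /eqP ->; rewrite -pN /=; case: odd.
Qed.

(** The odd rings and the even rings each have total measure at most that of [X]. *)
Let sum_rings : \sum_(0 <= k <oo) hausdorff d (ring_ k) < +oo.
Proof.
apply: (@le_lt_trans _ _ (hausdorff d X + hausdorff d X)); last by rewrite lte_add_pinfty.
apply: lime_le; first by apply: is_cvg_nneseries => *; exact: hausdorff_ge0.
apply: nearW => N; rewrite big_mkord (bigID (fun k : 'I_N => odd k == true)) /=.
apply: leeD.
  apply: le_trans (sum_rings_parity _ _) _; apply: le_hausdorff.
  by move=> x [k _ []].
rewrite (eq_bigl (fun k : 'I_N => odd k == false)); last by move=> k; case: odd.
apply: le_trans (sum_rings_parity _ _) _; apply: le_hausdorff.
by move=> x [k _ []].
Qed.

(** The rings of index at least [N] form the tail of a convergent series, at most [e] in measure.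
    The rest of the positive part lies above [a N], hence at positive distance from the sublevel
    set, and there the metric property applies. *)
Lemma hausdorff_split_sublevel :
  hausdorff d (X `&` [set x | (u x <= 0)%R]) +
  hausdorff d (X `&` ~` [set x | (u x <= 0)%R]) <= hausdorff d X.
Proof.
apply/lee_addgt0Pr => e e0.
have /fine_cvgP[_ /cvgrPdist_lt/(_ e e0)] :=
  nneseries_tail_cvg sum_rings (fun k _ => hausdorff_ge0 d (ring_ k)).
case=> N _ /(_ N (leqnn N)) /=; rewrite sub0r normrN.
set T := (X in fine X) => TN.
have T0 : 0 <= T by apply: nneseries_ge0 => *; exact: hausdorff_ge0.
have {TN} Te : T <= e%:E.
  have Tf : T \is a fin_num.
    rewrite ge0_fin_numE //; apply: le_lt_trans sum_rings.
    rewrite (nneseries_split _ N) => [|*]; last exact: hausdorff_ge0.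
    by rewrite leeDr // sume_ge0 // => *; exact: hausdorff_ge0.
  by rewrite -(fineK Tf) lee_fin; apply/ltW/(le_lt_trans (ler_norm _)).
pose B := X `&` [set x | (a N < u x)%R].
have subB : X `&` ~` [set x | (u x <= 0)%R] `<=`
    B `|` \bigcup_(k in ~` `I_N) ring_ k.
  move=> x [Xx /negP]; rewrite -ltNge => ux.
  have [|uN] := ltP (a N) (u x); first by left; split.
  have [m am] : exists m, (a m < u x)%R.
    have [m _ /(_ m (leqnn m)) /= ?] := near_infty_natSinv_lt (PosNum ux).
    by exists m.
  have exm : exists m, (fun m => (a m < u x)%R) m by exists m.
  (* The least index with [a m < u x] is not [0], because [u x <= a N <= a 0]; its predecessor is
     the index of the ring of [x]. *)
  case: (ex_minnP exm) => -[|k] ak kmin.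
    by have := le_lt_trans (le_trans uN (a_anti (leq0n N))) ak; rewrite ltxx.
  right; exists k; last split => //=.
    move=> /= kN; have := le_lt_trans (le_trans uN (a_anti kN)) ak.
    by rewrite ltxx.
  by rewrite ak leNgt /=; apply/negP => /kmin; rewrite ltnn.
apply: (@le_trans _ _ (hausdorff d (X `&` [set x | (u x <= 0)%R]) +
    (hausdorff d B + T))).
  rewrite leeD2l //; apply: le_trans (le_hausdorff d subB) _.
  apply: le_trans (outer_measureU2 _ _ _) _; rewrite leeD2l //.
  exact: (outer_measure_sigma_subadditive_tail (@hausdorff R n d)).
rewrite addeA leeD // addeC.
apply: le_trans (gap (a_gt0 N) _ _) _.
- by move=> x [_ /ltW].
- by move=> x [].
- by apply: le_hausdorff => x [[]|[]].
Qed.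

End caratheodory_criterion.

(** * The restricted Hausdorff measure as a Borel measure *)

Section hausdorff_measure.
Context {R : realType} (n d : nat).
Local Open Scope ereal_scope.

Lemma closed_caratheodory (F : set 'rV[R]_n) : closed F ->
  (@hausdorff R n d).-caratheodory F.
Proof.
move=> cF; have [->|/set0P F0] := eqVneq F set0.
  exact: (caratheodory_measurable_set0 (@hausdorff R n d)).
apply: (@le_caratheodory_measurable _ _ (@hausdorff R n d)) => X.
rewrite -[leRHS]/(hausdorff d X).
have [->|Xoo] := eqVneq (hausdorff d X) +oo; first by rewrite leey.
rewrite (closed_set_dist0 cF F0); apply: hausdorff_split_sublevel.
  by move=> x y; exact: set_dist_lipschitz.
by rewrite ltey.
Qed.

Lemma borel_caratheodory (A : set (borel R n)) : measurable A ->
  (@hausdorff R n d).-caratheodory (A : set 'rV[R]_n).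
Proof.
move: A; apply: smallest_sub; first split.
- exact: (caratheodory_measurable_set0 (@hausdorff R n d)).
- move=> A; rewrite setTD.
  exact: (@caratheodory_measurable_setC _ _ (@hausdorff R n d)).
- exact: (@caratheodory_measurable_bigcup _ _ (@hausdorff R n d)).
move=> A oA; rewrite -(setCK A).
apply: (@caratheodory_measurable_setC _ _ (@hausdorff R n d)).
by apply: closed_caratheodory; apply: open_closedC.
Qed.

Variable E : set 'rV[R]_n.

Lemma hausdorff_restr0 : hausdorff_restr d E set0 = 0.
Proof. by rewrite /hausdorff_restr set0I hausdorff0. Qed.

Lemma hausdorff_restr_ge0 A : 0 <= hausdorff_restr d E A.
Proof. exact: hausdorff_ge0. Qed.

(** One inequality is subadditivity; the other is Caratheodory's splitting along the [A k], tested
    on the intersection of [E] with their union. *)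
Lemma hausdorff_restr_semi_sigma_additive :
  semi_sigma_additive (hausdorff_restr d E).
Proof.
move=> A mA tA _.
have cA k : (@hausdorff R n d).-caratheodory (A k : set 'rV[R]_n).
  exact: borel_caratheodory.
suff -> : hausdorff_restr d E (\bigcup_k A k) =
    \sum_(0 <= k <oo) hausdorff_restr d E (A k).
  by apply: is_cvg_nneseries => *; exact: hausdorff_restr_ge0.
rewrite /hausdorff_restr setIC; apply/eqP; rewrite eq_le; apply/andP; split.
  under eq_eseriesr do rewrite setIC.
  exact: (outer_measure_bigcup_lim (@hausdorff R n d)).
pose X := E `&` \bigcup_k A k.
have : \sum_(0 <= k <oo) hausdorff d (X `&` A k) +
    hausdorff d (X `&` ~` \bigcup_k A k) <= hausdorff d X.
  exact: (caratheodory_lime_le cA tA).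
rewrite -[X `&` ~` _]setIA setICr setI0 hausdorff0 adde0; apply: le_trans.
apply: lee_nneseries => [*|k _]; first exact: hausdorff_ge0.
by apply: le_hausdorff => x [Ax Ex]; split=> //; split=> //; exists k.
Qed.

HB.instance Definition _ := isMeasure.Build _ (borel R n) R (hausdorff_restr d E)
  hausdorff_restr0 hausdorff_restr_ge0 hausdorff_restr_semi_sigma_additive.

End hausdorff_measure.

(** * Quantitative linear independence *)

Section quantitative_independence.
Context {R : realType} (n : nat).
Implicit Types (v : nat -> 'rV[R]_n) (c : nat -> R).

(** Linear independence made quantitative and scale invariant: the coordinate functionals on the
    span have norm at most [(kappa * D)^-1]. Indexing by [nat] lets vectors be appended without
    casts. *)
Definition qindep (kappa D : R) (k : nat) v : Prop :=
  forall c j, (j < k)%N -> kappa * D * `|c j| <= enorm (\sum_(i < k) c i *: v i).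

(** The distance of [v k] from the span of its predecessors controls the coefficient [c k]. For
    another coefficient [c j], either [c k] is at least [kappa / 2] times as large and controls it,
    or the term in [v k] spoils at most half of the bound given by independence. *)
Lemma qindepS kappa delta D k v : 0 < kappa <= 1 -> 0 < delta <= 1 -> 0 < D ->
  qindep kappa D k v -> enorm (v k) <= D ->
  (forall c, delta * D <= enorm (v k - \sum_(i < k) c i *: v i)) ->
  qindep (delta * kappa / 2) D k.+1 v.
Proof.
move=> /andP[ka0 ka1] /andP[de0 de1] D0 vk vkD vkd c j jk.
rewrite big_ord_recr /=.
set s := \sum_(i < k) c i *: v i.
have ck : delta * D * `|c k| <= enorm (s + c k *: v k).
  have [->|ck0] := eqVneq (c k) 0; first by rewrite normr0 mulr0.
  have -> : s + c k *: v k = c k *: (v k - \sum_(i < k) (- c i / c k) *: v i).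
    rewrite scalerBr scaler_sumr addrC; congr (_ + _); rewrite -sumrN.
    by apply: eq_bigr => i _; rewrite scalerA -scaleNr mulrCA mulfV // mulr1 opprK.
  by rewrite enormZ mulrC ler_wpM2l // (vkd (fun i => - c i / c k)).
have dD : 0 < delta * D by rewrite mulr_gt0.
have kd : kappa * (delta * D) <= delta * D by rewrite ler_piMl // ltW.
have c0 i := normr_ge0 (c i).
move: jk; rewrite ltnS leq_eqVlt => /orP[/eqP ->|jk].
  apply: le_trans ck; rewrite ler_wpM2r // (_ : delta * kappa / 2 * D = kappa * (delta * D) / 2); last by ring.
  by rewrite ler_pdivrMr //; lra.
have [cjk|cjk] := lerP (kappa / 2 * `|c j|) `|c k|.
  apply: le_trans ck; apply: le_trans (ler_wpM2l (ltW dD) cjk).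
  by rewrite le_eqVlt; apply/orP; left; apply/eqP; ring.
have sj : kappa * D * `|c j| <= enorm s by exact: vk.
have := lerB_enorm s (- (c k *: v k)); rewrite opprK enormN enormZ.
have h1 : `|c k| * enorm (v k) <= kappa / 2 * `|c j| * D.
  by apply: ler_pM => //; apply: ltW.
have h2 : delta * kappa / 2 * D * `|c j| <= kappa * D * `|c j| / 2.
  rewrite (_ : delta * kappa / 2 * D * `|c j| = delta * (kappa * D * `|c j| / 2)); last by ring.
  by rewrite ler_piMl // divr_ge0 // !mulr_ge0 // ltW.
lra.
Qed.

Lemma qindep_row_free kappa D k v : 0 < kappa -> 0 < D -> qindep kappa D k v ->
  row_free (\matrix_(i < k) v i).
Proof.
move=> ka0 D0 vk; apply/inj_row_free => u u0; apply/rowP => j; rewrite mxE.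
(* The row vector is extended by zero to a sequence, as [qindep] expects. *)
pose c i : R := if insub i is Some i' then u 0 i' else 0.
have cE (i : 'I_k) : c i = u 0 i by rewrite /c valK.
have := vk c j (ltn_ord j); rewrite cE.
rewrite (_ : \sum_(i < k) _ = 0) ?enorm0; last first.
  apply: etrans u0; rewrite mulmx_sum_row; apply: eq_bigr => i _.
  by rewrite cE rowK.
by rewrite pmulr_rle0 ?mulr_gt0 // normr_le0 => /eqP.
Qed.

End quantitative_independence.

(** * Vectors whose mutual distances are nearly realized in [R^d] *)

Section almost_isometric_configuration.
Context {R : realType} (n d : nat).
Variables (v : nat -> 'rV[R]_n) (w : nat -> 'rV[R]_d) (kappa D eps : R).
Hypothesis D0 : 0 < D.
Hypothesis vD : forall i, (i <= d)%N -> enorm (v i) <= D.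
Hypothesis vw : forall i, (i <= d)%N ->
  `|enorm (v i) - enorm (w i)| <= eps * D.
Hypothesis vvww : forall i j, (i <= d)%N -> (j <= d)%N ->
  `|enorm (v i - v j) - enorm (w i - w j)| <= eps * D.

(** Polarization writes each inner product as half a combination of three squared norms. The norms
    are at most [2 * D] and [3 * D], since [eps <= 1], so each square errs by at most
    [5 * eps * D ^+ 2]; in total [15 / 2 <= 8]. *)
Let gram_near i j : eps <= 1 -> (i <= d)%N -> (j <= d)%N ->
  `|edot (v i) (v j) - edot (w i) (w j)| <= 8 * eps * D ^+ 2.
Proof.
move=> eps1 id jd.
have sq (a b : R) : 0 <= a -> 0 <= b -> a <= 2 * D -> `|a - b| <= eps * D ->
    `|a ^+ 2 - b ^+ 2| <= 5 * eps * D ^+ 2.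
  move=> a0 b0 aD ab; have eD : eps * D <= D by rewrite ler_piMl // ltW.
  rewrite subr_sqr normrM (ger0_norm (addr_ge0 a0 b0)).
  rewrite (_ : 5 * eps * D ^+ 2 = eps * D * (5 * D)); last by ring.
  apply: ler_pM => //; first exact: addr_ge0.
  by move: ab; rewrite ler_norml; lra.
have polar m (x y : 'rV[R]_m) :
    edot x y = (enorm x ^+ 2 + enorm y ^+ 2 - enorm (x - y) ^+ 2) / 2.
  by rewrite !enorm_sqr edotBl !edotBr (edotC y x); field.
have near i' (i'd : (i' <= d)%N) := sq _ _ (enorm_ge0 _) (enorm_ge0 _)
  (le_trans (vD i'd) (_ : D <= 2 * D)) (vw i'd).
have D2 : D <= 2 * D by rewrite ler_peMl ?ler1n ?(ltW D0).
have vDij : enorm (v i - v j) <= 2 * D.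
  by have := ler_enormB (v i) (v j); have := vD id; have := vD jd; lra.
have vij := sq _ _ (enorm_ge0 _) (enorm_ge0 _) vDij (vvww id jd).
have vi := near D2 i id; have vj := near D2 j jd.
have eD0 : 0 <= eps * D ^+ 2 by move: vi; have := normr_ge0 (enorm (v i) ^+ 2 - enorm (w i) ^+ 2); lra.
rewrite !polar; move: vi vj vij; rewrite !ler_norml; lra.
Qed.

(* The [d + 1] vectors [w i] of R^d satisfy a linear relation; since the Gram
   matrices of [v] and [w] are close, the same relation almost holds for [v],
   and by independence it involves [v d] with a coefficient bounded below. *)
Lemma almost_dependent : 0 < kappa <= 1 -> qindep kappa D d v ->
  exists c : nat -> R, enorm (v d - \sum_(i < d) c i *: v i) ^+ 2 <=
    32 * d.+1%:R ^+ 2 / kappa ^+ 2 * eps * D ^+ 2.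
Proof.
move=> /andP[ka0 ka1] vk; set K := (X in X * eps).
have D20 : 0 < D ^+ 2 by rewrite exprn_gt0.
have k20 : 0 < kappa ^+ 2 by rewrite exprn_gt0.
have k21 : kappa ^+ 2 <= 1 by rewrite exprn_ile1 // ltW.
have d21 : 1 <= d.+1%:R ^+ 2 :> R by rewrite exprn_ege1 // ler1n.
have K1 : 1 <= K.
  rewrite ler_pdivlMr // mul1r; apply: le_trans k21 _; apply: le_trans d21 _.
  by rewrite ler_peMl ?exprn_ge0 ?ler0n ?ler1n.
(* For such [eps] the claim is weaker than [enorm (v d) <= D], and zero coefficients suffice. *)
have trivial : 1 <= K * eps -> exists c : nat -> R,
    enorm (v d - \sum_(i < d) c i *: v i) ^+ 2 <= K * eps * D ^+ 2.
  move=> Ke; exists (fun=> 0); rewrite big1 => [|i _]; last by rewrite scale0r.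
  rewrite subr0; apply: (@le_trans _ _ (D ^+ 2)); last by rewrite ler_peMl // ltW.
  by rewrite ler_pXn2r ?nnegrE // ?vD // ltW.
have [eps1|eps1] := lerP 1 eps.
  by apply: trivial; rewrite (le_trans eps1) // ler_peMl // (le_trans ler01).
pose W : 'M[R]_(d.+1, d) := \matrix_(i < d.+1) w i.
have [l lW l0] : exists2 l : 'rV[R]_d.+1, l *m W = 0 & l != 0.
  have : kermx W != 0.
    rewrite kermx_eq0 -row_leq_rank -ltnNge.
    by rewrite (leq_ltn_trans (rank_leq_col _)).
  move=> ker0; exists (nz_row (kermx W)); last by rewrite nz_row_eq0.
  exact/sub_kermxP/nz_row_sub.
(* The relation is measured against its largest coefficient, of modulus [L]. *)
pose i0 := [arg max_(i > ord0 | true) `|l 0 i|]%O.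
have i0P j : `|l 0 j| <= `|l 0 i0|.
  by rewrite /i0; case: arg_maxP => // i _; apply.
have L0 : 0 < `|l 0 i0|.
  rewrite normr_gt0; apply: contraNneq l0 => l0; apply/eqP/rowP => j.
  by apply/eqP; rewrite mxE -normr_le0; apply: le_trans (i0P j) _; rewrite l0 normr0.
set L := `|l 0 i0| in i0P L0.
pose N := enorm (\sum_(i < d.+1) l 0 i *: v i).
(* The double sum over Gram entries vanishes for [w]; for [v] each of its [d.+1 ^ 2] terms changes
   by at most [L ^+ 2] times the bound of [gram_near]. *)
have N2 : N ^+ 2 <= 8 * d.+1%:R ^+ 2 * L ^+ 2 * eps * D ^+ 2.
  have dbl m (z : nat -> 'rV[R]_m) : enorm (\sum_(i < d.+1) l 0 i *: z i) ^+ 2 =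
      \sum_(i < d.+1) \sum_(j < d.+1) l 0 i * l 0 j * edot (z i) (z j).
    rewrite enorm_sqr edot_suml; apply: eq_bigr => i _.
    rewrite edot_sumr; apply: eq_bigr => j _.
    by rewrite edotZl edotZr mulrA.
  have w0 : enorm (\sum_(i < d.+1) l 0 i *: w i) = 0.
    rewrite (_ : \sum_(i < _) _ = 0) ?enorm0 //; apply: etrans lW.
    by rewrite mulmx_sum_row; apply: eq_bigr => i _; rewrite rowK.
  rewrite -[leLHS]subr0 -[X in _ - X](expr0n _ 2) -w0 /N !dbl -sumrB.
  apply: (@le_trans _ _ (\sum_(i < d.+1) \sum_(j < d.+1) L ^+ 2 * (8 * eps * D ^+ 2))).
    apply: ler_sum => i _; rewrite -sumrB; apply: ler_sum => j _.
    rewrite -mulrBr; apply: le_trans (ler_norm _) _; rewrite normrM.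
    apply: ler_pM => //; first by rewrite normrM expr2 ler_pM.
    by apply: gram_near; rewrite ?(ltW eps1) // -ltnS ltn_ord.
  rewrite !sumr_const card_ord -!mulrnA -[X in X <= _]mulr_natr natrM.
  by rewrite le_eqVlt; apply/orP; left; apply/eqP; ring.
pose ld := l 0 ord_max.
have Nd : N = enorm (\sum_(i < d) l 0 (widen_ord (leqnSn d) i) *: v i + ld *: v d).
  by rewrite /N big_ord_recr.
pose c i : R := if insub i is Some i' then l 0 (widen_ord (leqnSn d) i') else 0.
have cE (i : 'I_d) : c i = l 0 (widen_ord (leqnSn d) i) by rewrite /c valK.
have {}Nd : N = enorm (\sum_(i < d) c i *: v i + ld *: v d).
  by rewrite Nd; congr (enorm (_ + _)); apply: eq_bigr => i _; rewrite cE.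
have KN : N ^+ 2 <= K * kappa ^+ 2 / 4 * eps * D ^+ 2 * L ^+ 2.
  apply: le_trans N2 _; rewrite /K mulfVK ?gt_eqF //.
  by rewrite le_eqVlt; apply/orP; left; apply/eqP; field.
have L20 : 0 < L ^+ 2 by rewrite exprn_gt0.
(* If the coefficient of [v d] is comparable to [L], solve the relation for [v d]; the factor
   [4 / kappa ^+ 2] lost here turns the [8] above into the [32] of [K]. *)
have [ldL|ldL] := lerP (kappa / 2 * L) `|ld|.
  have ld0 : 0 < `|ld| by apply: lt_le_trans ldL; rewrite !mulr_gt0.
  exists (fun i => - c i / ld).
  have -> : v d - \sum_(i < d) (- c i / ld) *: v i =
      ld^-1 *: (\sum_(i < d) c i *: v i + ld *: v d).
    rewrite scalerDr scalerA mulVf -?normr_gt0 // scale1r scaler_sumr addrC -sumrN.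
    by congr (_ + _); apply: eq_bigr => i _; rewrite scalerA mulNr scaleNr opprK mulrC.
  rewrite enormZ -Nd exprMn normfV exprVn mulrC ler_pdivrMr ?exprn_gt0 //.
  have N20 : 0 <= K * eps * D ^+ 2.
    have := le_trans (sqr_ge0 N) KN.
    rewrite (_ : _ * L ^+ 2 = K * eps * D ^+ 2 * (kappa ^+ 2 / 4 * L ^+ 2)); last by ring.
    by rewrite pmulr_lge0 // mulr_gt0 // divr_gt0.
  apply: le_trans KN _.
  rewrite (_ : _ * L ^+ 2 = K * eps * D ^+ 2 * ((kappa / 2 * L) ^+ 2)); last by field.
  by rewrite ler_wpM2l // ler_pXn2r ?nnegrE // !mulr_ge0 // ltW.
(* Otherwise the largest coefficient sits at an index below [d]. Independence then forces
   [N >= kappa * D * L / 2], and comparison with the upper bound for [N] gives [1 <= K * eps]. *)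
apply: trivial.
have i0d : (i0 < d)%N.
  rewrite ltn_neqAle -ltnS ltn_ord andbT; apply/eqP => i0d.
  have e : i0 = ord_max by apply: val_inj.
  move: ldL; rewrite /ld -e -/L => ?.
  have : kappa / 2 * L <= L by rewrite ler_piMl ?(ltW L0) //; lra.
  lra.
have sL := vk c i0 i0d.
have cL : c i0 = l 0 i0.
  by rewrite (cE (Ordinal i0d)); congr (l 0 _); apply: val_inj.
rewrite cL -/L in sL.
have h1 : `|ld| * enorm (v d) <= kappa / 2 * L * D by apply: ler_pM => //; [exact: ltW|exact: vD].
have h2 : kappa * D * L / 2 <= N.
  have := lerB_enorm (\sum_(i < d) c i *: v i) (- (ld *: v d)).
  rewrite opprK enormN enormZ -Nd; lra.
have : (kappa * D * L / 2) ^+ 2 <= N ^+ 2.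
  by rewrite ler_pXn2r ?nnegrE ?enorm_ge0 // !mulr_ge0 // ltW.
move=> /le_trans/(_ KN).
rewrite (_ : (kappa * D * L / 2) ^+ 2 = kappa ^+ 2 / 4 * D ^+ 2 * L ^+ 2 * 1); last by field.
rewrite (_ : K * _ / 4 * eps * _ * _ = kappa ^+ 2 / 4 * D ^+ 2 * L ^+ 2 * (K * eps)); last by ring.
by rewrite ler_pM2l // !mulr_gt0.
Qed.

End almost_isometric_configuration.

(** * Neighbourhoods of planes carry little mass *)

Lemma measure_bigsetU_le d (T : measurableType d) (R : realType)
    (mu : {measure set T -> \bar R}) (I : Type) (s : seq I) (B : I -> set T) :
  (forall i, measurable (B i)) ->
  (mu (\big[setU/set0]_(i <- s) B i) <= \sum_(i <- s) mu (B i))%E.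
Proof.
move=> mB; elim: s => [|i s IH]; first by rewrite !big_nil measure0.
rewrite !big_cons; apply: le_trans (measureU2 mu (mB i) _) _.
  exact: bigsetU_measurable.
exact: leeD2l.
Qed.

Section near_span.
Context {R : realType} (n d : nat) (C : R) (E : set 'rV[R]_n).
Hypothesis regE : regular d C E.

Lemma regular_ball_le (x : 'rV[R]_n) (r : R) : E x -> 0 < r ->
  (r%:E < 2%:E * ediam E)%E ->
  (hausdorff_restr d E (eball x r) <= (C * r ^+ d)%:E)%E.
Proof. by case: regE => _ _ h Ex r0 rE; have /andP[] := h x r Ex r0 rE. Qed.

Lemma regular_ball_ge (x : 'rV[R]_n) (r : R) : E x -> 0 < r ->
  (r%:E < 2%:E * ediam E)%E ->
  ((C^-1 * r ^+ d)%:E <= hausdorff_restr d E (eball x r))%E.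
Proof. by case: regE => _ _ h Ex r0 rE; have /andP[] := h x r Ex r0 rE. Qed.

Lemma lt_2ediam (r D : R) : 0 < D -> (D%:E <= ediam E)%E -> r < 2 * D ->
  (r%:E < 2%:E * ediam E)%E.
Proof.
move=> D0 DE rD; apply: (@lt_le_trans _ _ (2%:E * D%:E)%E).
  by rewrite -EFinM lte_fin.
by rewrite lee_pmul2l // lte_fin.
Qed.

Variables (S : set 'rV[R]_n) (x0 : 'rV[R]_n) (v : nat -> 'rV[R]_n) (k : nat).
Variables (kappa delta D : R).
Hypothesis D0 : 0 < D.
Hypothesis DE : (D%:E <= ediam E)%E.
Hypothesis C0 : 0 <= C.
Hypothesis SE : S `<=` E.
Hypothesis SD : forall y, S y -> enorm (y - x0) <= D.
Hypothesis kd : (k < d)%N.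
Hypothesis ka : 0 < kappa <= 1.
Hypothesis de0 : 0 < delta.
Hypothesis de1 : d.+2%:R * delta <= 1.
Hypothesis vk : qindep kappa D k v.
Hypothesis vD : forall i, (i < k)%N -> enorm (v i) <= D.

Definition near_span : set 'rV[R]_n :=
  [set y | S y /\ exists c : nat -> R,
     enorm (y - x0 - \sum_(i < k) c i *: v i) < delta * D].

Let ka0 : 0 < kappa. Proof. by case/andP: ka. Qed.
Let ka1 : kappa <= 1. Proof. by case/andP: ka. Qed.

Let de_le1 : delta <= 1.
Proof. by apply: le_trans de1; rewrite ler_peMl ?ler1n // ltW. Qed.

(** Both [y - x0] and its deviation from the combination have norm at most [D], so the combination
    has norm at most [2 * D]. *)
Let coef_le (c : nat -> R) y : S y -> enorm (y - x0 - \sum_(i < k) c i *: v i) < delta * D ->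
  forall i, (i < k)%N -> `|c i| <= 2 / kappa.
Proof.
move=> Sy yc i ik; rewrite ler_pdivlMr // -(@ler_pM2r _ D) //.
apply: le_trans (_ : enorm (\sum_(i < k) c i *: v i) <= _).
  by apply: le_trans (vk c ik); rewrite le_eqVlt; apply/orP; left; apply/eqP; ring.
have := lerB_enorm (\sum_(i < k) c i *: v i) (y - x0); rewrite (enormBC (\sum_(_ < _) _)).
have := SD Sy; have : delta * D <= D by rewrite ler_piMl // ltW.
lra.
Qed.

(** Translates admissible coefficients to nonnegative numbers and rescales steps of length [delta]
    to length one, so that [Num.trunc] yields the index in the grid. *)
Let shift (c : R) := c / delta + 2 / (kappa * delta).
Let M := Num.trunc (4 / (kappa * delta)).

Let shift_itv c : `|c| <= 2 / kappa -> 0 <= shift c <= 4 / (kappa * delta).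
Proof.
rewrite ler_norml => /andP[c1 c2].
have -> : shift c = (c + 2 / kappa) / delta by rewrite /shift; field; rewrite !gt_eqF.
have -> : 4 / (kappa * delta) = (2 / kappa + 2 / kappa) / delta by field; rewrite !gt_eqF.
rewrite divr_ge0 ?(ltW de0) //=; last by rewrite -(opprK c) addrC subr_ge0 lerNl.
by rewrite ler_pM2r ?invr_gt0 // lerD2r.
Qed.

Let cell (tau : {ffun 'I_k -> 'I_M.+1}) : set 'rV[R]_n :=
  [set y | S y /\ exists c : nat -> R,
     enorm (y - x0 - \sum_(i < k) c i *: v i) < delta * D /\
     forall i : 'I_k, `|c i| <= 2 / kappa /\ Num.trunc (shift (c i)) = tau i].

Let near_span_cell y : near_span y -> exists tau, cell tau y.
Proof.
move=> [Sy [c yc]]; have cle := coef_le Sy yc.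
exists [ffun i : 'I_k => inord (Num.trunc (shift (c i)))]; split => //; exists c.
split => // i; split; first exact: cle.
rewrite ffunE inordK // ltnS; apply: le_truncn.
by have /andP[] := shift_itv (cle _ (ltn_ord i)).
Qed.

(** Each point is within [delta * D] of its combination, which accounts for the [2] in [d.+2]; the
    two combinations differ by fewer than [d] terms of norm at most [delta * D]. *)
Let cell_diam tau y z : cell tau y -> cell tau z ->
  enorm (y - z) < d.+2%:R * delta * D.
Proof.
move=> [_ [b [yb bP]]] [_ [c [zc cP]]].
have bc (i : 'I_k) : `|b i - c i| <= delta.
  have [bi bt] := bP i; have [ci ct] := cP i.
  have /andP[b0 _] := shift_itv bi; have /andP[c0 _] := shift_itv ci.
  have := truncn_itv b0; have := truncn_itv c0; rewrite bt ct.
  move: (nat_of_ord _) => m; rewrite -natr1 => /andP[c1 c2] /andP[b1 b2].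
  have -> : b i - c i = (shift (b i) - shift (c i)) * delta.
    by rewrite /shift; field; rewrite !gt_eqF.
  rewrite normrM (gtr0_norm de0) ler_piMl ?(ltW de0) // ler_norml.
  by move: (shift _) (shift _) b1 b2 c1 c2 => p q; lra.
have -> : y - z = (y - x0 - \sum_(i < k) b i *: v i) -
    (z - x0 - \sum_(i < k) c i *: v i) + \sum_(i < k) (b i - c i) *: v i.
  have -> : \sum_(i < k) (b i - c i) *: v i =
      \sum_(i < k) b i *: v i - \sum_(i < k) c i *: v i.
    by rewrite -sumrB; apply: eq_bigr => i _; rewrite scalerBl.
  move: (\sum_(i < k) _) (\sum_(i < k) _) => p q.
  by apply/rowP => i; rewrite !mxE; ring.
apply: le_lt_trans (ler_enormD _ _) _.
have sum_le : enorm (\sum_(i < k) (b i - c i) *: v i) <= d%:R * (delta * D).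
  apply: le_trans (ler_enorm_sum _) _.
  apply: (@le_trans _ _ (\sum_(i < k) delta * D)).
    by apply: ler_sum => i _; rewrite enormZ ler_pM // vD.
  rewrite sumr_const card_ord -[_ *+ k]mulr_natl ler_wpM2r ?mulr_ge0 ?(ltW D0) ?(ltW de0) //.
  by rewrite ler_nat ltnW.
have := ler_enormB (y - x0 - \sum_(i < k) b i *: v i)
    (z - x0 - \sum_(i < k) c i *: v i).
rewrite -addn2 natrD -mulrA mulrDl; lra.
Qed.

(** As [kappa * delta <= 1], each direction has at most [5 / (kappa * delta)] indices. The exponent
    of [5 / kappa >= 1] may be raised to [d], but that of [delta] has to remain [k]. *)
Let card_cells : (#|{ffun 'I_k -> 'I_M.+1}|%:R : R) <= (5 / kappa) ^+ d / delta ^+ k.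
Proof.
rewrite card_ffun !card_ord natrX.
have kd0 : 0 < kappa * delta by rewrite mulr_gt0.
have M1 : M.+1%:R <= 5 / kappa / delta :> R.
  have M4 : M%:R <= 4 / (kappa * delta) :> R by rewrite truncn_le divr_ge0 // ltW.
  have : 1 <= 1 / (kappa * delta) :> R.
    by rewrite ler_pdivlMr // mul1r mulr_ile1 // ltW.
  rewrite -natr1 -mulrA -invfM; lra.
apply: le_trans (_ : (5 / kappa / delta) ^+ k <= _).
  by apply: lerXn2r; rewrite // nnegrE ?divr_ge0 // ltW.
rewrite [in leLHS]expr_div_n ler_pM2r ?invr_gt0 ?exprn_gt0 //.
apply: ler_weXn2l; last exact: ltnW.
by rewrite ler_pdivlMr // mul1r (le_trans ka1) // ler1n.
Qed.

(* The coefficients of near points in the span are bounded by independence, so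
   a grid of [delta ^ - k] cells covers them; each cell carries measure of order
   [delta ^ d], and [k < d]. *)
Lemma near_span_measure : exists N : set (borel R n),
  [/\ measurable N, near_span `<=` N &
   (hausdorff_restr d E N <=
     (C * (5 * d.+2%:R / kappa) ^+ d * delta * D ^+ d)%:E)%E].
Proof.
pose r := d.+2%:R * delta * D.
have r0 : 0 < r by rewrite !mulr_gt0.
have rE : (r%:E < 2%:E * ediam E)%E.
  apply: (lt_2ediam D0 DE); apply: (@le_lt_trans _ _ D); last by rewrite ltr_pMl ?ltr1n.
  by rewrite /r ler_piMl // ltW.
(* A nonempty cell lies in a measurable ball around any of its points; the centre is in [E], so
   regularity bounds its measure. *)
have /choice[B BP] tau : exists B : set (borel R n),
    [/\ measurable B, cell tau `<=` B &
     (hausdorff_restr d E B <= (C * r ^+ d)%:E)%E].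
  have [[z zP]|nz] := pselect (exists z, cell tau z).
    exists (eball z r); split; first exact: eball_measurable.
      by move=> y yP; apply: cell_diam yP zP.
    by apply: regular_ball_le => //; apply: SE; case: zP.
  exists set0; split; [exact: measurable0|by move=> y yP; case: nz; exists y|].
  by rewrite measure0 lee_fin mulr_ge0 // exprn_ge0 // ltW.
exists (\big[setU/set0]_tau B tau); split.
- by apply: bigsetU_measurable => tau _; have [] := BP tau.
- move=> y /near_span_cell [tau yt]; rewrite -bigcup_seq.
  by exists tau; [rewrite /= mem_index_enum|have [_ + _] := BP tau; apply].
apply: le_trans (measure_bigsetU_le _ _ _) _; first by move=> tau; have [] := BP tau.
apply: (@le_trans _ _ (\sum_(tau : {ffun 'I_k -> 'I_M.+1}) (C * r ^+ d)%:E)%E).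
  by apply: lee_sum => tau _; have [] := BP tau.
rewrite sumEFin lee_fin sumr_const -[_ *+ _]mulr_natl.
apply: le_trans (ler_wpM2r _ card_cells) _; first by rewrite mulr_ge0 // exprn_ge0 // ltW.
(* Here [k < d] enters: one factor [delta] survives the division by the number of cells. *)
have dk : delta ^+ d <= delta ^+ k * delta.
  by rewrite -exprSr; apply: ler_wiXn2l; rewrite // ltW.
rewrite /r !exprMn !exprVn.
set a := 5 ^+ d; set b := _%:R ^+ d; set e := kappa ^+ d.
have -> : a / e / delta ^+ k * (C * (b * delta ^+ d * D ^+ d)) =
    C * (a * b / e) * (delta ^+ d / delta ^+ k) * D ^+ d by ring.
rewrite ler_pM2r ?exprn_gt0 // ler_wpM2l //.
  by rewrite mulr_ge0 // divr_ge0 ?mulr_ge0 ?exprn_ge0 // ltW.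
by rewrite ler_pdivrMr ?exprn_gt0 // mulrC.
Qed.

End near_span.

(** * Markov selection *)

Section selection.
Context d (T : measurableType d) (R : realType) (mu : {measure set T -> \bar R}).
Local Open Scope ereal_scope.

Import HBNNSimple.

(* Meant for inner integrals [g] of functions of two variables, whose
   measurability would otherwise call for Fubini's theorem. *)
Lemma ge0_integral_ge_cst (D A : set T) (g : T -> \bar R) (c : R) :
  measurable A -> A `<=` D -> (0 <= c)%R -> (forall x, D x -> 0 <= g x) ->
  (forall x, A x -> c%:E <= g x) -> c%:E * mu A <= \int[mu]_(x in D) g x.
Proof.
move=> mA AD c0 g0 gA; rewrite ge0_integralE //; apply: ereal_sup_ubound.
exists (scale_nnsfun (indic_nnsfun R mA) c0).
  move=> x /=; rewrite patchE measurable_realfun.mindicE.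
  have [xA|xA] := boolP (x \in A).
    by rewrite inE in xA; rewrite mulr1 mem_set ?gA //; exact: AD.
  by rewrite mulr0; case: ifPn => //; rewrite inE; apply: g0.
by rewrite sintegralrM sintegral_indic // setIT.
Qed.

Variables (S : set T) (m t : R) (h : T -> T -> R).
Hypothesis mS : measurable S.
Hypothesis muS : mu S = m%:E.
Hypothesis m0 : (0 < m)%R.
Hypothesis t0 : (0 < t)%R.
Hypothesis h0 : forall x y, (0 <= h x y)%R.
Hypothesis mh : forall x, S x -> measurable_fun S (h x).

Let G x := \int[mu]_(y in S) (h x y)%:E.

Hypothesis Gt : \int[mu]_(x in S) G x < (t * m ^+ 2)%:E.

(** The set [N] and the points where some [h (x i)] exceeds its threshold take at most [m / 4] each,
    the latter by Markov's inequality. If [G] were large on all the rest, of measure at least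
    [m / 2], its integral would be at least [2 * t * m ^+ 2]. *)
Lemma select_point (D k : nat) (x : nat -> T) (N : set T) : (k <= D.+1)%N ->
  (forall i, (i < k)%N -> S (x i) /\ G (x i) <= (4 * t * m)%:E) ->
  measurable N -> mu N <= (m / 4)%:E ->
  exists y, [/\ S y, ~ N y, G y <= (4 * t * m)%:E &
    forall i, (i < k)%N -> (h (x i) y <= 16 * D.+1%:R * t)%R].
Proof.
move=> kD xP mN muN.
have D1 : (0 < D.+1%:R :> R)%R by rewrite ltr0n.
(* Makes each of the at most [D.+1] exceptional sets no larger than [m / (4 * D.+1)]. *)
pose L := (16 * D.+1%:R * t)%R.
have L0 : (0 < L)%R by rewrite !mulr_gt0.
pose B (i : 'I_k) := S `&` [set y | L%:E <= `|(h (x i) y)%:E|].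
have mhE (i : 'I_k) : measurable_fun S (fun y => (h (x i) y)%:E).
  by apply/measurable_EFinP; apply: mh; have [] := xP i (ltn_ord i).
have mB i : measurable (B i).
  by apply: emeasurable_fun_c_infty => //; apply: measurableT_comp.
have muB i : mu (B i) <= (m / (4 * D.+1%:R))%:E.
  have [Sx Gx] := xP i (ltn_ord i).
  have := le_integral_abse mu mS (mhE i) L0.
  rewrite (eq_integral (fun y => (h (x i) y)%:E)); last first.
    by move=> y _; rewrite gee0_abs // lee_fin.
  move=> /le_trans/(_ Gx).
  have fB : mu (B i) \is a fin_num.
    rewrite ge0_fin_numE //; apply: (@le_lt_trans _ _ (mu S)).
      by apply: le_measure; rewrite ?inE //; apply: subIsetl.
    by rewrite muS ltry.
  rewrite -/(B i) -(fineK fB) -EFinM !lee_fin => LB.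
  rewrite -(@ler_pM2l _ L) //; apply: le_trans LB _.
  by rewrite /L le_eqVlt; apply/orP; left; apply/eqP; field; rewrite gt_eqF.
pose U := \big[setU/set0]_(i < k) B i.
have mU : measurable U by apply: bigsetU_measurable.
have muU : mu U <= (m / 4)%:E.
  apply: le_trans (measure_bigsetU_le _ _ mB) _.
  apply: (@le_trans _ _ (\sum_(i < k) (m / (4 * D.+1%:R))%:E)).
    by apply: lee_sum => i _; exact: muB.
  rewrite sumEFin lee_fin sumr_const card_ord -[(_ *+ k)%R]mulr_natr.
  rewrite (_ : m / _ * _ = m / 4 * (k%:R / D.+1%:R))%R; last first.
    by field; rewrite gt_eqF.
  by rewrite ler_piMr ?divr_ge0 ?(ltW m0) // ler_pdivrMr // mul1r ler_nat.
pose A := S `\` (N `|` U).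
have mA : measurable A by apply: measurableD => //; apply: measurableU.
have fA : mu A \is a fin_num.
  rewrite ge0_fin_numE //; apply: (@le_lt_trans _ _ (mu S)).
    by apply: le_measure; rewrite ?inE //; apply: subDsetl.
  by rewrite muS ltry.
have muA : (m / 2 <= fine (mu A))%R.
  have : m%:E <= mu A + ((m / 4)%:E + (m / 4)%:E).
    rewrite -muS; apply: (@le_trans _ _ (mu (A `|` (N `|` U)))).
      apply: le_measure; rewrite ?inE //.
        by do 2![apply: measurableU => //].
      move=> y Sy; have [NUy|NUy] := pselect ((N `|` U) y); first by right.
      by left.
    apply: le_trans (measureU2 _ mA (measurableU _ _ mN mU)) _.
    rewrite leeD2l //; apply: le_trans (measureU2 _ mN mU) _.
    exact: leeD.
  by rewrite -[X in X + _](fineK fA) -!EFinD lee_fin; move: (fine _) => a; lra.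
apply: contrapT => noy.
have GA y : A y -> (4 * t * m)%:E <= G y.
  move=> [Sy /not_orP[Ny Uy]]; rewrite leNgt; apply/negP => Gy.
  apply: noy; exists y; split => //; first exact: ltW.
  move=> i ik; rewrite leNgt; apply/negP => hL; apply: Uy.
  rewrite /U -bigcup_seq; exists (Ordinal ik); first by rewrite /= mem_index_enum.
  by split=> //=; rewrite lee_fin ger0_norm // ltW.
have c0 : (0 <= 4 * t * m)%R by rewrite !mulr_ge0 // ltW.
have G0 y : S y -> 0 <= G y by move=> _; apply: integral_ge0 => z _; rewrite lee_fin.
have := ge0_integral_ge_cst mA (@subDsetl _ _ _) c0 G0 GA.
move=> /le_lt_trans/(_ Gt); rewrite -(fineK fA) -EFinM lte_fin.
apply/negP; rewrite -leNgt.
apply: (@le_trans _ _ (4 * t * m * (m / 2))%R); last by rewrite ler_wpM2l.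
rewrite (_ : 4 * t * m * (m / 2) = 2 * (t * m ^+ 2))%R; last by field.
by rewrite ler_peMl ?ler1n // mulr_ge0 ?exprn_ge0 // ltW.
Qed.

End selection.

(** * Choice of a nondegenerate simplex *)

Section dilation_of_cube.
Context {R : realType} (n d : nat) (C : R) (E Q : set 'rV[R]_n).
Hypothesis d0 : (0 < d)%N.
Hypothesis C1 : 1 <= C.
Hypothesis regE : regular d C E.
Hypothesis QE : Q `<=` E.
Hypothesis Qoo : (ediam Q < +oo)%E.
Variables (x0 : 'rV[R]_n) (r : R).
Hypothesis Ex0 : E x0.
Hypothesis r0 : 0 < r.
Hypothesis rE : (r%:E < 2%:E * ediam E)%E.
Hypothesis rQ : eball x0 r `&` E `<=` Q.

(** With [l] the diameter of [Q], points of the dilation lie within [l] of [Q], so [D <= 3 * l]; the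
    ball of radius [l] about [x0] meets [E] inside the dilation, so the mass is at least
    [C^-1 * l ^+ d]. *)
Lemma dilation2 : exists D m : R,
  [/\ 0 < D, 0 < m, ediam (dilation E 2 Q) = D%:E, (D%:E <= ediam E)%E &
   [/\ measurable (dilation E 2 Q : set (borel R n)),
     hausdorff_restr d E (dilation E 2 Q) = m%:E,
     C^-1 * (D / 3) ^+ d <= m & dilation E 2 Q `<=` E]].
Proof.
set S := dilation E 2 Q.
have C0 : 0 < C by apply: lt_le_trans C1.
have Qx0 : Q x0 by apply: rQ; split=> //; apply: eball_center.
have fQ : ediam Q \is a fin_num by rewrite ge0_fin_numE // ediam_ge0.
pose l := fine (ediam Q); have lQ : ediam Q = l%:E by rewrite fineK.
have lge0 : 0 <= l by rewrite fine_ge0 // ediam_ge0.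
have l0 : 0 < l.
  rewrite lt_def lge0 andbT; apply/eqP => l0.
  have : (hausdorff_restr d E (eball x0 r) <= hausdorff d [set x0])%E.
    apply: le_hausdorff => y /rQ Qy; apply/eqP; rewrite -subr_eq0; apply/eqP.
    apply: enorm_eq0; apply/eqP; rewrite eq_le enorm_ge0 andbT.
    by rewrite -lee_fin -[in leRHS]l0 -lQ ediam_ge.
  rewrite hausdorff_set1 // leNgt => /negP; apply.
  apply: lt_le_trans (regular_ball_ge regE Ex0 r0 rE).
  by rewrite lte_fin mulr_gt0 ?invr_gt0 ?exprn_gt0.
have SE' : S = E `&` [set x | set_dist x Q <= l].
  apply/seteqP; split=> x [Ex xl]; split => //; move: xl => /=;
  by rewrite lQ -EFinM lee_fin (_ : 2 - 1 = 1) ?mul1r //; ring.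
have SE : S `<=` E by rewrite SE'; apply: subIsetl.
have cE : closed E by case: regE.
have mS : measurable (S : set (borel R n)).
  rewrite SE'; apply: measurableI; first exact: closed_measurable_borel.
  rewrite (_ : [set x | _] = ~` [set x | l < set_dist x Q]).
    apply: measurableC; apply: open_measurable_borel.
    apply: (@lipschitz_open_gt _ _ _ 1) => // x y.
    by rewrite mul1r set_dist_lipschitz.
  by apply/seteqP; split => x /=; rewrite leNgt => /negP.
have QS : Q `<=` S.
  move=> x Qx; rewrite SE'; split; first exact: QE.
  by apply: le_trans (set_dist_le _ Qx) _; rewrite subrr enorm0.
have S3 : (ediam S <= (3 * l)%:E)%E.
  apply: ediam_le; first by rewrite lee_fin mulr_ge0.
  move=> x y; rewrite SE' => -[_ /= xl] [_ /= yl]; rewrite lee_fin.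
  apply/ler_addgt0Pr => e e0.
  have le2 : l < l + e / 2 by rewrite ltrDl divr_gt0.
  have Q0 : Q !=set0 by exists x0.
  have [a Qa xa] := set_dist_lt Q0 (le_lt_trans xl le2).
  have [b Qb yb] := set_dist_lt Q0 (le_lt_trans yl le2).
  have := ediam_ge Qa Qb; rewrite lQ lee_fin.
  have := ler_edistD a x y; have := ler_edistD b a y; rewrite (enormBC b y).
  by move: xa yb; lra.
have fS : ediam S \is a fin_num.
  by rewrite ge0_fin_numE ?ediam_ge0 //; apply: le_lt_trans S3 _; rewrite ltry.
pose D := fine (ediam S); have DS : ediam S = D%:E by rewrite fineK.
have lD : l <= D by rewrite -lee_fin -lQ -DS le_ediam.
have D3 : D <= 3 * l by rewrite -lee_fin -DS.
have D0 : 0 < D by apply: lt_le_trans lD.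
have DE : (D%:E <= ediam E)%E by rewrite -DS le_ediam.
have lE : (l%:E <= ediam E)%E by rewrite -lQ le_ediam.
have muS_ge : ((C^-1 * l ^+ d)%:E <= hausdorff_restr d E S)%E.
  apply: le_trans (regular_ball_ge regE Ex0 l0 _) _.
    by apply: (lt_2ediam l0 lE); rewrite ltr_pMl ?ltr1n.
  apply: le_hausdorff => y [yl Ey]; split => //; rewrite SE'; split => //=.
  by apply: le_trans (set_dist_le _ Qx0) _; apply: ltW.
have fmu : hausdorff_restr d E S \is a fin_num.
  rewrite ge0_fin_numE ?hausdorff_restr_ge0 //.
  (* The radius exceeds [D], so that the open ball contains [S], and stays below [2 * D], so that
     regularity applies. *)
  apply: (@le_lt_trans _ _ (C * (3 / 2 * D) ^+ d)%:E); last by rewrite ltry.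
  have D32 : 0 < 3 / 2 * D by rewrite mulr_gt0 // divr_gt0.
  apply: le_trans (regular_ball_le regE Ex0 D32 _).
    apply: le_hausdorff => y [Sy Ey]; split => //; rewrite /eball /=.
    apply: (@le_lt_trans _ _ D); first by rewrite -lee_fin -DS ediam_ge //; exact: QS.
    by move: D0; lra.
  by apply: (lt_2ediam D0 DE); move: D0; lra.
pose m := fine (hausdorff_restr d E S).
have mE : hausdorff_restr d E S = m%:E by rewrite fineK.
have lm : C^-1 * l ^+ d <= m by rewrite -lee_fin -mE.
exists D, m; split=> //.
  by apply: lt_le_trans lm; rewrite mulr_gt0 ?invr_gt0 ?exprn_gt0.
split=> //; apply: le_trans lm; rewrite ler_pM2l ?invr_gt0 //.
apply: lerXn2r; rewrite ?nnegrE ?divr_ge0 // ?(ltW D0) //.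
by rewrite ler_pdivrMr // mulrC.
Qed.

End dilation_of_cube.

Section selection_constants.
Context {R : realType} (d : nat) (C : R).

(** Solves the equation in [sel_deltaE]: the mass bound of [near_span_measure] becomes a quarter of
    the lower bound for the mass of the dilated cube. *)
Definition sel_delta (kappa : R) : R :=
  kappa ^+ d / (4 * C ^+ 2 * (15 * d.+2%:R) ^+ d).

(** Follows the loss of independence in [qindepS], starting from the empty family. *)
Fixpoint sel_kappa (k : nat) : R :=
  if k is k'.+1 then sel_delta (sel_kappa k') * sel_kappa k' / 2 else 1.

Hypothesis d0 : (0 < d)%N.
Hypothesis C1 : 1 <= C.

Let C0 : 0 < C. Proof. exact: lt_le_trans C1. Qed.

Lemma sel_delta_gt0 kappa : 0 < kappa -> 0 < sel_delta kappa.
Proof. by move=> k0; rewrite divr_gt0 ?mulr_gt0 ?exprn_gt0 ?mulr_gt0. Qed.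

(** This is the smallness condition of [near_span_measure], which keeps the radius of the covering
    balls at most [D]. *)
Lemma sel_delta_le kappa : 0 < kappa <= 1 -> d.+2%:R * sel_delta kappa <= 1.
Proof.
move=> /andP[k0 k1]; have d20 : 0 < d.+2%:R :> R by rewrite ltr0n.
rewrite /sel_delta mulrA ler_pdivrMr ?mulr_gt0 ?exprn_gt0 ?mulr_gt0 // mul1r.
apply: (@le_trans _ _ (d.+2%:R)).
  by rewrite ler_piMr ?(ltW d20) // exprn_ile1 // ltW.
have d15 : d.+2%:R <= 15 * d.+2%:R :> R by rewrite ler_peMl ?ler1n // ltW.
apply: (le_trans d15); apply: (@le_trans _ _ ((15 * d.+2%:R) ^+ d)).
  rewrite -[leLHS]expr1; apply: ler_weXn2l => //.
  by apply: le_trans d15; rewrite ler1n.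
rewrite ler_peMl ?exprn_ge0 ?mulr_ge0 //; apply: (@le_trans _ _ (4 * 1)).
  by rewrite mulr1 ler1n.
by rewrite ler_pM2l // exprn_ege1.
Qed.

Lemma sel_delta_le1 kappa : 0 < kappa <= 1 -> sel_delta kappa <= 1.
Proof.
move=> k01; apply: le_trans (sel_delta_le k01); rewrite ler_peMl ?ler1n //.
by case/andP: k01 => k0 _; rewrite ltW // sel_delta_gt0.
Qed.

Lemma sel_kappa_itv k : 0 < sel_kappa k <= 1.
Proof.
elim: k => [|k IH]; first by rewrite ltr01 lexx.
rewrite -[sel_kappa k.+1]/(sel_delta (sel_kappa k) * sel_kappa k / 2).
have /andP[k0 k1] := IH; have dk := sel_delta_gt0 k0.
apply/andP; split; first by rewrite divr_gt0 // mulr_gt0.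
rewrite ler_pdivrMr // mul1r.
apply: (@le_trans _ _ 1); last by rewrite ler1n.
by rewrite mulr_ile1 ?sel_delta_le1 // ltW.
Qed.

Lemma sel_deltaE kappa D : 0 < kappa ->
  C * (5 * d.+2%:R / kappa) ^+ d * sel_delta kappa * D ^+ d =
  C^-1 * (D / 3) ^+ d / 4.
Proof.
move=> k0; rewrite /sel_delta (_ : 15 * d.+2%:R = 3 * (5 * d.+2%:R)); last by ring.
have : (5 * d.+2%:R : R) != 0 by rewrite mulf_neq0 ?pnatr_eq0.
move: (5 * _) => e e0; rewrite (exprMn d 3) !expr_div_n.
have : e ^+ d != 0 by rewrite expf_neq0.
have : kappa ^+ d != 0 by rewrite expf_neq0 ?gt_eqF.
have : (3 : R) ^+ d != 0 by rewrite expf_neq0 ?pnatr_eq0.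
move: (e ^+ d) (kappa ^+ d) (3 ^+ d) (D ^+ d) => e' k s D' s0 k1 e1.
by field; rewrite s0 k1 e1 gt_eqF.
Qed.

End selection_constants.

Section selection_of_simplex.
Context {R : realType} (n d : nat) (C : R) (E S : set 'rV[R]_n) (D m t : R).
Variable h : 'rV[R]_n -> 'rV[R]_n -> R.
Hypothesis d0 : (0 < d)%N.
Hypothesis C1 : 1 <= C.
Hypothesis regE : regular d C E.
Hypothesis D0 : 0 < D.
Hypothesis DE : (D%:E <= ediam E)%E.
Hypothesis SE : S `<=` E.
Hypothesis SD : forall x y, S x -> S y -> enorm (x - y) <= D.
Hypothesis mS : measurable (S : set (borel R n)).
Hypothesis muS : hausdorff_restr d E S = m%:E.
Hypothesis m0 : 0 < m.
Hypothesis mD : C^-1 * (D / 3) ^+ d <= m.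
Hypothesis t0 : 0 < t.
Hypothesis h0 : forall x y, 0 <= h x y.
Hypothesis mh : forall x, S x -> measurable_fun (S : set (borel R n)) (h x).

Let G (x : 'rV[R]_n) := (\int[hausdorff_restr d E]_(y in S) (h x y)%:E)%E.

Hypothesis Gt : (\int[hausdorff_restr d E]_(x in S) G x < (t * m ^+ 2)%:E)%E.

(** By induction, the next point is selected outside the neighbourhood of the span of the earlier
    ones, whose mass is at most [m / 4] by the choice of [sel_delta]; [qindepS] then preserves
    independence. *)
Lemma select_simplex k : (k <= d)%N -> exists x : nat -> 'rV[R]_n,
  [/\ forall i, (i <= k)%N -> S (x i) /\ (G (x i) <= (4 * t * m)%:E)%E,
    forall i j, (i < j <= k)%N -> h (x i) (x j) <= 16 * d.+1%:R * t &
    qindep (sel_kappa d C k) D k (fun i => x i.+1 - x 0%N)].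
Proof.
elim: k => [_|k IH kd].
  have [||y [Sy _ Gy _]] := select_point mS muS m0 t0 h0 mh Gt (D := d) (leq0n _)
    (x := fun=> 0) (N := set0) _ measurable0.
  - by [].
  - by rewrite measure0 lee_fin divr_ge0 // ltW.
  exists (fun=> y); split => [i _|i j|c j] //.
  by case: j => [|j]; rewrite ?ltn0 ?andbF.
have [x [xP xx xi]] := IH (ltnW kd).
have kap := sel_kappa_itv d0 C1 k; have /andP[ka0 ka1] := kap.
have de0 : 0 < sel_delta d C (sel_kappa d C k) by apply: sel_delta_gt0.
have Sx i : (i <= k)%N -> S (x i) by move=> /xP[].
have C0 : 0 <= C by apply: le_trans C1.
have vD i : (i < k)%N -> enorm (x i.+1 - x 0%N) <= D.
  by move=> ik; apply: SD; exact: Sx.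
have [N [mN nearN muN]] := near_span_measure regE D0 DE C0 SE
    (fun y Sy => SD Sy (Sx 0%N isT)) kd kap de0 (sel_delta_le d0 C1 kap) xi vD.
have {}muN : (hausdorff_restr d E N <= (m / 4)%:E)%E.
  apply: le_trans muN _; rewrite lee_fin sel_deltaE //.
  by rewrite ler_pM2r ?invr_gt0.
have [y [Sy Ny Gy hy]] := select_point mS muS m0 t0 h0 mh Gt (k := k.+1) (D := d)
  (ltnW kd) (fun i ik => xP i ik) mN muN.
pose x' i := if (i <= k)%N then x i else y.
have x'E i : (i <= k)%N -> x' i = x i by rewrite /x' => ->.
have x'k : x' k.+1 = y by rewrite /x' ltnn.
exists x'; split.
- move=> i; rewrite leq_eqVlt => /orP[/eqP ->|ik]; first by rewrite x'k.
  by rewrite x'E //; apply: xP.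
- move=> i j /andP[ij]; rewrite leq_eqVlt => /orP[/eqP jk|jk].
    by rewrite jk x'k x'E ?hy // -ltnS -jk.
  by rewrite !x'E // ?xx ?ij // -ltnS (leq_trans ij) // ltnW.
have sumE (c : nat -> R) : \sum_(i < k) c i *: (x' i.+1 - x' 0%N) =
    \sum_(i < k) c i *: (x i.+1 - x 0%N).
  by apply: eq_bigr => i _; rewrite !x'E.
apply: qindepS => //.
- by rewrite de0 sel_delta_le1.
- by move=> c j jk; rewrite sumE; apply: xi.
- by rewrite x'k x'E // SD //; apply: Sx.
- move=> c; rewrite sumE x'k x'E // leNgt; apply/negP => yc.
  by apply: Ny; apply: nearN; split => //; exists c.
Qed.

End selection_of_simplex.

(** * Projections and power means *)

Section orthogonal_projection.
Context {R : realType} (n : nat).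

Lemma orthonormal_row_free k (B : 'M[R]_(k, n)) : B *m B^T = 1%:M -> row_free B.
Proof.
move=> BB; apply/inj_row_free => u uB0.
by rewrite -[u]mulmx1 -BB mulmxA uB0 mul0mx.
Qed.

(** Gram-Schmidt: while [k < \rank A], some row of [A] lies outside the row space of [B], and its
    component orthogonal to [B], normalized, extends the family. *)
Lemma orthonormal_subbasis (A : 'M[R]_n) k : (k <= \rank A)%N ->
  exists B : 'M[R]_(k, n), B *m B^T = 1%:M /\ (B <= A)%MS.
Proof.
elim: k => [_|k IH kA].
  by exists 0; split; [apply/matrixP => -[] | apply: sub0mx].
have [B [BB BA]] := IH (ltnW kA).
have rB : \rank B = k by apply/eqP; exact: orthonormal_row_free.
have [i iA] : exists i, ~~ (row i A <= B)%MS.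
  by apply/row_subPn/negP => /mxrankS; rewrite rB leqNgt kA.
pose e := row i A - row i A *m B^T *m B.
have eA : (e <= A)%MS.
  rewrite addmx_sub ?row_sub // eqmx_opp.
  by rewrite (submx_trans _ BA) // submxMl.
have eB : e *m B^T = 0 by rewrite /e mulmxBl -(mulmxA (_ *m B^T)) BB mulmx1 subrr.
have e0 : enorm e != 0.
  apply: contra iA => /eqP/enorm_eq0/subr0_eq ->.
  by rewrite submxMl.
pose e' := (enorm e)^-1 *: e.
have e'B : e' *m B^T = 0 by rewrite -scalemxAl eB scaler0.
have e'e' : e' *m e'^T = 1%:M.
  apply/rowP => j; rewrite ord1 -edotE edotZl edotZr -enorm_sqr !mxE eqxx /=.
  by field.
have on : col_mx e' B *m (col_mx e' B)^T = 1%:M.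
  rewrite tr_col_mx mul_col_row e'e' e'B BB (_ : B *m e'^T = 0).
    by rewrite -scalar_mx_block.
  by apply: trmx_inj; rewrite trmx_mul trmxK e'B trmx0.
exists (col_mx e' B); split; first exact: on.
have : (col_mx e' B <= A)%MS by rewrite col_mx_sub BA andbT scalemx_sub.
by [].
Qed.

Lemma orthonormal_basis (A : 'M[R]_n) : exists B : 'M[R]_(\rank A, n),
  B *m B^T = 1%:M /\ (B :=: A)%MS.
Proof.
have [B [BB BA]] := orthonormal_subbasis (leqnn (\rank A)).
exists B; split=> //; apply/eqmxP; rewrite BA /=.
have /eqP rB := orthonormal_row_free BB.
by rewrite -(mxrank_leqif_sup BA) rB.
Qed.

(** Identifies the point chosen by [get]: testing the orthogonality of two candidates against each
    other shows that their difference has norm zero. *)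
Lemma orth_projE (V : set 'rV[R]_n) (x y : 'rV[R]_n) : V y ->
  (forall v, V v -> edot (x - y) (v - y) = 0) -> orth_proj V x = y.
Proof.
move=> Vy yP.
have [] : [set y | V y /\ forall v, V v -> edot (x - y) (v - y) = 0] (orth_proj V x).
  by apply: (@getPex _ [set y | V y /\ forall v, V v -> edot (x - y) (v - y) = 0]); exists y.
move: (orth_proj V x) => z Vz zP; apply/eqP; rewrite -subr_eq0; apply/eqP.
apply: edot_eq0; have := yP _ Vz; have := zP _ Vy.
rewrite !edotBl !edotBr (edotC y z) => h1 h2.
by move: h1 h2; move: (edot _ _) (edot x z) (edot x y) (edot z z) => *; lra.
Qed.

(** The projection is [p + (x - p) *m B^T *m B], and right multiplication by the orthonormal [B]
    preserves norms. *)
Lemma orth_proj_coordinates (V : set 'rV[R]_n) d : affine_planes d V ->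
  exists B : 'M[R]_(d, n), B *m B^T = 1%:M /\
    forall x x', enorm (orth_proj V x - orth_proj V x') = enorm ((x - x') *m B^T).
Proof.
move=> [p [A [<- VE]]]; have [B [BB BA]] := orthonormal_basis A.
have VB z : V z <-> exists u, z = p + u *m B.
  rewrite VE /= -BA; split=> [/submxP[u zu]|[u ->]].
    by exists u; rewrite -zu addrC subrK.
  by rewrite addrC addKr submxMl.
have piE x : orth_proj V x = p + (x - p) *m B^T *m B.
  apply: orth_projE; first by apply/VB; eexists.
  move=> v /VB [u ->]; set w := (x - p) *m B^T *m B.
  have -> : p + u *m B - (p + w) = (u - (x - p) *m B^T) *m B.
    by rewrite opprD addrACA subrr add0r mulmxBl.
  have -> : x - (p + w) = (x - p) - w by rewrite opprD addrA.
  rewrite edotE trmx_mul mulmxA mulmxBl.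
  by rewrite -(mulmxA (_ *m B^T)) BB mulmx1 subrr mul0mx mxE.
exists B; split=> // x x'; rewrite !piE opprD addrACA subrr add0r.
rewrite -!mulmxBl opprB addrA subrK.
by rewrite /enorm !edotE trmx_mul mulmxA -(mulmxA (_ *m B^T)) BB mulmx1.
Qed.

(** Cauchy-Schwarz for [z] and [z *m B^T *m B], the latter having the norm of [z *m B^T]. *)
Lemma orthonormal_contraction k (B : 'M[R]_(k, n)) (z : 'rV[R]_n) :
  B *m B^T = 1%:M -> enorm (z *m B^T) <= enorm z.
Proof.
move=> BB; have [->|nz] := eqVneq (enorm (z *m B^T)) 0; first exact: enorm_ge0.
have {nz} : 0 < enorm (z *m B^T) by rewrite lt_def nz enorm_ge0.
move=> /ler_pM2r <-; rewrite -expr2 enorm_sqr.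
have -> : edot (z *m B^T) (z *m B^T) = edot z (z *m B^T *m B).
  by rewrite !edotE !trmx_mul trmxK !mulmxA.
apply: le_trans (edot_le _ _) _; rewrite ler_wpM2l //.
by rewrite /enorm !edotE [X in _ *m X]trmx_mul mulmxA -(mulmxA (_ *m B^T)) BB mulmx1.
Qed.

End orthogonal_projection.

Lemma contraction_measurable (R : realType) n m (f : 'rV[R]_n -> 'rV[R]_m) :
  (forall x y, enorm (f x - f y) <= enorm (x - y)) ->
  measurable_fun [set: borel R n] (f : borel R n -> borel R m).
Proof.
move=> f1.
apply: (@measurability _ _ (borel R n) (borel R m) _ _ (@open 'rV[R]_m)) => // _ [A oA <-].
rewrite setTI; apply: open_measurable_borel; rewrite openE => x Afx.
have /nbhs_eballP [r r0 rA] : nbhs (f x) A by apply: open_nbhs_nbhs.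
apply/nbhs_eballP; exists r => // y xy; apply: rA.
exact: le_lt_trans (f1 _ _) xy.
Qed.

Section coefficient_comparison.
Context {R : realType} (n d : nat) (E : set 'rV[R]_n).
Local Open Scope ereal_scope.
Let mu := hausdorff_restr d E.

(** Allows the target space to change, from [R^n] for projections to [R^d] for coordinates. *)
Lemma eq_distortion (q : R) (S : set (borel R n)) k l
    (f : 'rV[R]_n -> 'rV[R]_k) (g : 'rV[R]_n -> 'rV[R]_l) :
  (forall x y, enorm (f x - f y) = enorm (g x - g y)) ->
  distortion mu q S f = distortion mu q S g.
Proof.
move=> fg; pose F (e : 'rV[R]_n -> 'rV[R]_n -> R) := ((mu S ^+ 2)^-1 *
  \int[mu]_(x in S) \int[mu]_(y in S)
    ((`| enorm (x - y) - e x y | / fine (ediam S))%R `^ q)%:E) `^ q^-1.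
rewrite -[LHS]/(F (fun x y => enorm (f x - f y))).
rewrite -[RHS]/(F (fun x y => enorm (g x - g y))).
by congr F; apply/funext => x; apply/funext => y.
Qed.

Lemma iota_eucl_le_planes (q : R) (S : set (borel R n)) :
  iota_eucl mu d q S <= iota_planes mu d q S.
Proof.
apply: le_ereal_inf_tmp => _ [V /orth_proj_coordinates [B [BB BE]] <-].
apply: ereal_inf_lbound; exists (fun x => x *m B^T) => /=.
  apply: measurable_funTS; apply: contraction_measurable => x y.
  by rewrite -mulmxBl orthonormal_contraction.
by apply: eq_distortion => x y; rewrite BE mulmxBl.
Qed.

End coefficient_comparison.

(** * Comparison of the means of order [q] and [2q] *)

Section power_mean.
Context d (T : measurableType d) (R : realType) (mu : {measure set T -> \bar R}).
Local Open Scope ereal_scope.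
Variables (S : set T) (m : R) (u : T -> R) (q : R).
Hypothesis mS : measurable S.
Hypothesis muS : mu S = m%:E.
Hypothesis m0 : (0 < m)%R.
Hypothesis mu_u : measurable_fun S u.
Hypothesis q0 : (0 < q)%R.

Lemma power_mean :
  ((mu S)^-1 * \int[mu]_(x in S) (u x `^ q)%:E) `^ q^-1 <=
  ((mu S)^-1 * \int[mu]_(x in S) (u x `^ (2 * q))%:E) `^ (2 * q)^-1.
Proof.
have iS : (mu S)^-1 = (m^-1)%:E by rewrite muS inver gt_eqF.
have q20 : (0 < 2 * q)%R by rewrite mulr_gt0.
have mp p : measurable_fun S (fun x => (u x `^ p)%:E).
  by apply/measurable_EFinP; apply: (measurableT_comp (measurable_powR p)).
have p0 p x : 0 <= (u x `^ p)%:E by rewrite lee_fin powR_ge0.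
have i0 p : 0 <= \int[mu]_(x in S) (u x `^ p)%:E by apply: integral_ge0.
rewrite iS; case b: (\int[mu]_(x in S) (u x `^ (2 * q))%:E) => [B| |]; last 2 first.
- by rewrite gt0_muley ?lte_fin ?invr_gt0 // poweRyr ?leey // invr_neq0 // gt_eqF.
- by have := i0 (2 * q)%R; rewrite b.
have B0 : (0 <= B)%R by rewrite -lee_fin -b.
(* AM-GM: [u^q <= l / 2 + u^(2q) / (2 l)], to be used with [l] the mean of [u^q]. *)
have amgm (l : R) : (0 < l)%R -> \int[mu]_(x in S) (u x `^ q)%:E <=
    (l / 2 * m + (2 * l)^-1 * B)%:E.
  move=> l0; have l20 : (0 < (2 * l)^-1)%R by rewrite invr_gt0 mulr_gt0.
  have l02 : (0 <= l / 2)%R by rewrite divr_ge0 // ltW.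
  rewrite EFinD (EFinM (2 * l)^-1) -b (EFinM (l / 2)) -muS -integral_cst //.
  rewrite -ge0_integralZl_EFin ?(ltW l20) // -ge0_integralD //; last 2 first.
  - by move=> x _; rewrite mule_ge0 // lee_fin ltW.
  - by apply: measurable_funeM.
  apply: ge0_le_integral => //.
  - by apply: emeasurable_funD => //; apply: measurable_funeM.
  move=> x _; rewrite /cst -EFinM -EFinD lee_fin (mulrC 2%R q) powRrM powR_mulrn ?powR_ge0 //.
  move: (_ `^ q)%R => a.
  rewrite -subr_ge0 (_ : _ - _ = (2 * l)^-1 * (l - a) ^+ 2)%R; last first.
    by field; rewrite gt_eqF.
  by rewrite mulr_ge0 ?sqr_ge0 // ltW.
(* The parameter [1] already shows that the integral of [u^q] is finite. *)
case a: (\int[mu]_(x in S) (u x `^ q)%:E) => [A| |]; last 2 first.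
- by have := amgm 1%R ltr01; rewrite a.
- by have := i0 q; rewrite a.
have A0 : (0 <= A)%R by rewrite -lee_fin -a.
rewrite -!EFinM !poweR_EFin lee_fin.
have Am0 : (0 <= m^-1 * A)%R by rewrite mulr_ge0 // invr_ge0 ltW.
have -> : ((m^-1 * A) `^ q^-1 = ((m^-1 * A) ^+ 2) `^ (2 * q)^-1)%R.
  by rewrite -powR_mulrn // -powRrM invfM mulrA divff // mul1r.
apply: ge0_ler_powR; rewrite ?nnegrE ?invr_ge0 ?(ltW q20) ?exprn_ge0 //.
  by rewrite mulr_ge0 // invr_ge0 ltW.
have [->|An0] := eqVneq A 0%R; first by rewrite mulr0 expr0n mulr_ge0 // invr_ge0 ltW.
have {An0} A0' : (0 < A)%R by rewrite lt_def An0.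
have := amgm (m^-1 * A)%R; rewrite mulr_gt0 ?invr_gt0 // a lee_fin => /(_ isT).
rewrite -(@ler_pM2l _ (2 * m^-1 * (m^-1 * A))%R) ?mulr_gt0 ?invr_gt0 //.
rewrite (_ : 2 * m^-1 * (m^-1 * A) * (m^-1 * A / 2 * m + _) =
  (m^-1 * A) ^+ 2 + m^-1 * B)%R; last by field; rewrite !gt_eqF.
rewrite (_ : 2 * m^-1 * (m^-1 * A) * A = (m^-1 * A) ^+ 2 + (m^-1 * A) ^+ 2)%R; last by ring.
by rewrite lerD2l.
Qed.

End power_mean.

(** * The main estimate *)

Section main_estimate.
Context {R : realType} (n d : nat) (C : R) (E S : set 'rV[R]_n) (D m q : R).
Hypothesis d0 : (0 < d)%N.
Hypothesis C1 : 1 <= C.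
Hypothesis regE : regular d C E.
Hypothesis D0 : 0 < D.
Hypothesis DS : ediam S = D%:E.
Hypothesis DE : (D%:E <= ediam E)%E.
Hypothesis SE : S `<=` E.
Hypothesis mS : measurable (S : set (borel R n)).
Hypothesis muS : hausdorff_restr d E S = m%:E.
Hypothesis m0 : 0 < m.
Hypothesis mD : C^-1 * (D / 3) ^+ d <= m.
Hypothesis q1 : 1 <= q.

Let mu := hausdorff_restr d E.

Let q0 : 0 < q. Proof. exact: lt_le_trans q1. Qed.

Let fD : fine (ediam S) = D. Proof. by rewrite DS. Qed.

Let SD x y : S x -> S y -> enorm (x - y) <= D.
Proof. by move=> Sx Sy; rewrite -lee_fin -DS ediam_ge. Qed.

Lemma set_dist_measurable_on (V : set 'rV[R]_n) :
  measurable_fun (S : set (borel R n)) (fun x => set_dist x V / fine (ediam S)).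
Proof.
apply: measurable_funM => //.
by apply: measurable_funTS; apply: set_dist_measurable.
Qed.

Lemma beta_planes_le : (beta_planes mu d q S <= beta_planes mu d (2 * q) S)%E.
Proof.
apply: le_ereal_inf_tmp => _ [V VP <-].
apply: le_trans (_ : _ <= ((mu S)^-1 *
  \int[mu]_(x in S) ((set_dist x V / fine (ediam S)) `^ q)%:E) `^ q^-1)%E _.
  by apply: ereal_inf_lbound; exists V.
exact: (power_mean mS muS m0 (set_dist_measurable_on V) q0).
Qed.

Lemma beta_planes_ge0 p : (0 <= beta_planes mu d p S)%E.
Proof. by apply: le_ereal_inf_tmp => _ [V _ <-]; apply: poweR_ge0. Qed.

Variable f : 'rV[R]_n -> 'rV[R]_d.
Hypothesis mf : measurable_fun (S : set (borel R n)) (f : borel R n -> borel R d).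

Let h (x y : 'rV[R]_n) : R :=
  (`|enorm (x - y) - enorm (f x - f y)| / fine (ediam S)) `^ q.

Let h_ge0 x y : 0 <= h x y. Proof. exact: powR_ge0. Qed.

Let hC x y : h x y = h y x.
Proof. by rewrite /h (enormBC x) (enormBC (f x)). Qed.

Let h_diag x : h x x = 0.
Proof. by rewrite /h !subrr !enorm0 subrr normr0 mul0r powR0 ?gt_eqF. Qed.

Let dist_measurable k (z : 'rV[R]_k) :
  measurable_fun [set: borel R k] ((fun y => enorm (z - y)) : borel R k -> R).
Proof.
apply: (@lipschitz_measurable _ _ _ 1) => // x y; rewrite mul1r ler_norml.
have h1 := ler_edistD x z y; have h2 := ler_edistD y z x.
by rewrite (enormBC y x) in h2; move: h1 h2; lra.
Qed.

Let mh x : S x -> measurable_fun (S : set (borel R n)) (h x).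
Proof.
move=> _; apply: (measurableT_comp (measurable_powR q)).
apply: measurable_funM => //; apply: measurableT_comp => //.
apply: measurable_funB; first by apply: measurable_funTS; apply: dist_measurable.
exact: (measurableT_comp (dist_measurable (f x)) mf).
Qed.

Let h_le (H : R) x y : 0 <= H -> h x y <= H ->
  `|enorm (x - y) - enorm (f x - f y)| <= H `^ q^-1 * D.
Proof.
move=> H0 hH; rewrite -ler_pdivrMr //.
have e0 : 0 <= `|enorm (x - y) - enorm (f x - f y)| / D by rewrite divr_ge0 // ltW.
rewrite -[leLHS](powRr1 e0) -(@divff _ q) ?gt_eqF // powRrM.
apply: ge0_ler_powR; rewrite ?nnegrE ?invr_ge0 ?powR_ge0 ?(ltW q0) //.
by rewrite -fD.
Qed.

(** The constant of [almost_dependent] for the independence of the selected simplex. *)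
Definition gram_const : R := 32 * d.+1%:R ^+ 2 / sel_kappa d C d ^+ 2.

Let gram_const_ge0 : 0 <= gram_const.
Proof. by rewrite divr_ge0 ?mulr_ge0 ?exprn_ge0 // ltW //; case/andP: (sel_kappa_itv d0 C1 d). Qed.

(** For fixed [y], all pairs among the [x i] and [y] have [h] at most [H], so [almost_dependent]
    applies with [eps] the [q]-th root of [H]. It bounds the squared distance to the plane, and
    raising to the power [q] makes the bound linear in [H], ready for integration. *)
Lemma plane_of_good_simplex (x : nat -> 'rV[R]_n) (L : R) : 0 <= L ->
  (forall i, (i <= d)%N -> S (x i)) ->
  (forall i j, (i < j <= d)%N -> h (x i) (x j) <= L) ->
  qindep (sel_kappa d C d) D d (fun i => x i.+1 - x 0%N) ->
  exists2 V, affine_planes d V & forall y, S y ->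
    (set_dist y V / fine (ediam S)) `^ (2 * q) <=
    gram_const `^ q * (L + \sum_(i < d.+1) h (x i) y).
Proof.
move=> L0 Sx xL xi; set v := fun i => x i.+1 - x 0%N.
have /andP[ka0 ka1] := sel_kappa_itv d0 C1 d.
(* [affine_planes] asks for a square matrix, hence the passage from [A] to [<<A>>]. *)
pose A := \matrix_(i < d) v i.
exists [set z | (z - x 0%N <= <<A>>)%MS].
  exists (x 0%N), <<A>>%MS; split => //.
  by rewrite mxrank_gen; apply/eqP; exact: (qindep_row_free ka0 D0 xi).
move=> y Sy; set V := [set z | _].
pose H := L + \sum_(i < d.+1) h (x i) y.
have hH i : (i <= d)%N -> h (x i) y <= H.
  move=> id; rewrite /H (bigD1 (inord i)) //= inordK //.
  by rewrite addrCA lerDl addr_ge0 // sumr_ge0.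
have LH : L <= H by rewrite lerDl sumr_ge0.
have H0 : 0 <= H by apply: le_trans LH.
(* [y] is appended as vertex [d.+1], so the last difference vector is [y - x 0]. *)
pose p i := if (i <= d)%N then x i else y.
have pE i : (i <= d)%N -> p i = x i by rewrite /p => ->.
have py : p d.+1 = y by rewrite /p ltnn.
have hp i j : (i <= d.+1)%N -> (j <= d.+1)%N -> h (p i) (p j) <= H.
  wlog ij : i j / (i <= j)%N => [hw id jd|].
    by have [/hw|/ltnW ji] := leqP i j; [apply|rewrite hC hw].
  move=> _; move: ij; rewrite leq_eqVlt => /orP[/eqP ->|ij]; first by rewrite h_diag.
  rewrite leq_eqVlt => /orP[/eqP jd|jd].
    by rewrite jd py pE ?hH // -ltnS -jd.
  rewrite !pE //; last exact: leq_trans (ltnW ij) jd.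
  by apply: le_trans LH; rewrite xL // ij.
have Sp i : (i <= d.+1)%N -> S (p i).
  by move=> _; rewrite /p; case: ifP => // /Sx.
pose vp i := p i.+1 - p 0%N; pose wp i := f (p i.+1) - f (p 0%N).
have vpE i : (i < d)%N -> vp i = v i by move=> id; rewrite /vp !pE.
have sumE c : \sum_(i < d) c i *: vp i = \sum_(i < d) c i *: v i.
  by apply: eq_bigr => i _; rewrite vpE.
have [c cle] : exists c : nat -> R, enorm (vp d - \sum_(i < d) c i *: vp i) ^+ 2 <=
    gram_const * H `^ q^-1 * D ^+ 2.
  apply: (@almost_dependent _ _ _ vp wp) => //.
  - by move=> i id; apply: SD; apply: Sp.
  - by move=> i id; apply: h_le => //; apply: hp.
  - move=> i j id jd.
    have -> : vp i - vp j = p i.+1 - p j.+1 by rewrite /vp opprB addrA subrK.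
    have -> : wp i - wp j = f (p i.+1) - f (p j.+1) by rewrite /wp opprB addrA subrK.
    by apply: h_le => //; apply: hp.
  - by rewrite ka0.
  - by move=> c j jd; rewrite sumE; apply: xi.
have distV : set_dist y V <= enorm (vp d - \sum_(i < d) c i *: vp i).
  have Vz : V (x 0%N + \sum_(i < d) c i *: v i).
    rewrite /V /= addrC addKr genmxE; apply: summx_sub => i _.
    by apply: scalemx_sub; rewrite -[v i](rowK (fun i : 'I_d => v i)) row_sub.
  apply: le_trans (set_dist_le _ Vz) _.
  by rewrite sumE opprD addrA /vp py pE.
rewrite -/H fD powRrM powR_mulrn ?divr_ge0 ?set_dist_ge0 ?(ltW D0) //.
have -> : H = (H `^ q^-1) `^ q by rewrite -powRrM mulVf ?gt_eqF // powRr1.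
rewrite -powRM ?powR_ge0 //.
apply: ge0_ler_powR; first exact: ltW.
- by rewrite nnegrE sqr_ge0.
- by rewrite nnegrE; apply: mulr_ge0; [exact: gram_const_ge0|exact: powR_ge0].
rewrite exprMn exprVn ler_pdivrMr ?exprn_gt0 //; apply: le_trans cle.
by rewrite ler_pXn2r ?nnegrE ?set_dist_ge0.
Qed.

(** The [20] is [16], from the pairs of vertices, plus [4], from the averages of [h (x i)] over
    [S]. *)
Definition main_const : R := (gram_const `^ q * (20 * d.+1%:R)) `^ q^-1.

(** The bound is strict so that [s], and with it [t], is positive even when the distortion vanishes.
    The estimate of [plane_of_good_simplex] is then averaged over [S]. *)
Lemma beta_le_distortion (s : R) : (distortion mu q S f < s%:E)%E ->
  (beta_planes mu d (2 * q) S ^+ 2 <= (main_const * s)%:E)%E.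
Proof.
move=> fs.
have s0 : 0 < s by rewrite -lte_fin; apply: le_lt_trans fs; apply: poweR_ge0.
pose t := s `^ q; have t0 : 0 < t by apply: powR_gt0.
have m20 : 0 < m ^+ 2 by rewrite exprn_gt0.
have G0 : (0 <= \int[mu]_(x in S) \int[mu]_(y in S) (h x y)%:E)%E.
  by apply: integral_ge0 => x _; apply: integral_ge0 => y _; rewrite lee_fin.
(* Otherwise dividing by [m ^+ 2] and taking the [q]-th root would give distortion at least [s]. *)
have Gt : (\int[mu]_(x in S) \int[mu]_(y in S) (h x y)%:E < (t * m ^+ 2)%:E)%E.
  rewrite ltNge; apply/negP => tG; move: fs; apply/negP; rewrite -leNgt.
  rewrite /distortion.
  have -> : s%:E = (t%:E `^ q^-1)%E.
    by rewrite poweR_EFin -powRrM mulfV ?gt_eqF // powRr1 // ltW.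
  have iS : ((mu S ^+ 2)^-1 = ((m ^+ 2)^-1)%:E)%E.
    by rewrite [mu S]muS -EFin_expe inver gt_eqF.
  rewrite iS; apply: gt0_ler_poweR; rewrite ?invr_ge0 ?(ltW q0) //.
  - by rewrite in_itv /= lee_fin (ltW t0) leey.
  - by rewrite in_itv /= leey andbT mule_ge0 // lee_fin invr_ge0 ltW.
  have -> : t%:E = (((m ^+ 2)^-1)%:E * (t * m ^+ 2)%:E)%E.
    by rewrite -EFinM mulrCA mulVf ?mulr1 // gt_eqF.
  by rewrite lee_pmul2l // lte_fin invr_gt0.
have [x [xP xx xi]] := select_simplex d0 C1 regE D0 DE SE SD mS muS m0 mD t0
  h_ge0 mh Gt (leqnn d).
pose L := 16 * d.+1%:R * t.
have L0 : 0 <= L by rewrite !mulr_ge0 // ltW.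
have Sx i : (i <= d)%N -> S (x i) by move=> /xP[].
have [V VP Vle] := plane_of_good_simplex L0 Sx xx xi.
have mhE i : (i <= d)%N -> measurable_fun (S : set (borel R n)) (fun y => (h (x i) y)%:E).
  by move=> id; apply/measurable_EFinP; apply: mh; apply: Sx.
have intV : (\int[mu]_(y in S) ((set_dist y V / fine (ediam S)) `^ (2 * q))%:E <=
    (gram_const `^ q * (20 * d.+1%:R * t * m))%:E)%E.
  have K0 : 0 <= gram_const `^ q by apply: powR_ge0.
  apply: (@le_trans _ _ (\int[mu]_(y in S) ((gram_const `^ q)%:E *
      (L%:E + \sum_(i < d.+1) (h (x i) y)%:E)))%E).
    apply: ge0_le_integral => //.
    - by move=> y _; rewrite lee_fin powR_ge0.
    - apply/measurable_EFinP; apply: (measurableT_comp (measurable_powR _)).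
      exact: set_dist_measurable_on.
    - apply: measurable_funeM; apply: emeasurable_funD => //.
      by apply: emeasurable_sum => i; apply: mhE; rewrite -ltnS ltn_ord.
    - by move=> y Sy; rewrite sumEFin -EFinD -EFinM lee_fin Vle.
  rewrite ge0_integralZl_EFin //; first last.
  - apply: emeasurable_funD => //.
    by apply: emeasurable_sum => i; apply: mhE; rewrite -ltnS ltn_ord.
  - by move=> y _; rewrite adde_ge0 ?lee_fin //; apply: sume_ge0 => i _; rewrite lee_fin.
  rewrite [leRHS]EFinM lee_wpmul2l ?lee_fin //.
  rewrite ge0_integralD //; first last.
  - by apply: emeasurable_sum => i; apply: mhE; rewrite -ltnS ltn_ord.
  - by move=> y _; apply: sume_ge0 => i _; rewrite lee_fin.
  rewrite integral_cst // ge0_integral_sum //; first last.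
  - by move=> i y _; rewrite lee_fin.
  - by move=> i; apply: (mhE i); rewrite -ltnS ltn_ord.
  apply: (@le_trans _ _ (L%:E * m%:E + \sum_(i < d.+1) (4 * t * m)%:E)%E).
    apply: leeD; first by rewrite -muS.
    by apply: lee_sum => i _; have [] := xP i (ltn_ord i).
  rewrite sumEFin sumr_const card_ord -EFinM -EFinD lee_fin.
  rewrite -[(4 * t * m) *+ _]mulr_natl.
  by rewrite le_eqVlt; apply/orP; left; apply/eqP; rewrite /L; ring.
have iS : ((mu S)^-1 = (m^-1)%:E)%E by rewrite [mu S]muS inver gt_eqF.
pose B := gram_const `^ q * (20 * d.+1%:R) * t.
have B0 : 0 <= B by rewrite !mulr_ge0 ?powR_ge0.
have betaB : (beta_planes mu d (2 * q) S <= (B `^ (2 * q)^-1)%:E)%E.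
  apply: (@le_trans _ _ (((mu S)^-1 *
    \int[mu]_(y in S) ((set_dist y V / fine (ediam S)) `^ (2 * q))%:E)
      `^ (2 * q)^-1)%E).
    by apply: ereal_inf_lbound; exists V.
  rewrite -poweR_EFin; apply: gt0_ler_poweR.
  - by rewrite invr_ge0 mulr_ge0 // ltW.
  - rewrite in_itv /= leey andbT mule_ge0 ?iS ?lee_fin ?invr_ge0 ?(ltW m0) //.
    by apply: integral_ge0 => y _; rewrite lee_fin powR_ge0.
  - by rewrite in_itv /= lee_fin B0 leey.
  rewrite iS; have -> : B%:E = ((m^-1)%:E * (gram_const `^ q * (20 * d.+1%:R * t * m))%:E)%E.
    by rewrite -EFinM; congr EFin; rewrite /B; field; rewrite gt_eqF.
  by rewrite lee_pmul2l // lte_fin invr_gt0.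
have -> : (main_const * s)%:E = ((B `^ (2 * q)^-1)%:E ^+ 2)%E.
  rewrite -EFin_expe -powR_mulrn ?powR_ge0 // -powRrM; congr EFin.
  rewrite invfM mulrAC mulVf // mul1r.
  rewrite /B powRM ?mulr_ge0 ?powR_ge0 ?(ltW t0) //.
  by rewrite -[t `^ _]powRrM mulfV ?gt_eqF // powRr1 // ltW.
by rewrite lee_sqr ?beta_planes_ge0 // lee_fin powR_ge0.
Qed.

End main_estimate.

Theorem proposition3p44 (R : realType) (d : nat) (q C : R) :
  (0 < d)%N -> 1 <= q -> 1 <= C ->
  exists2 Ct : R, 0 < Ct &
  forall (n : nat), (d < n)%N ->
  forall (E : set 'rV[R]_n), regular d C E ->
  forall (c0 : R) (Delta : int -> set (set 'rV[R]_n)),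
    0 < c0 < 1 -> dyadic_system E c0 Delta ->
  forall (j : int) (Q : set 'rV[R]_n), scales E j -> Delta j Q ->
  let mu := hausdorff_restr d E in
  let S := dilation E 2 Q in
  [/\ (beta_planes mu d q S ^+ 2 <= beta_planes mu d (2 * q) S ^+ 2)%E,
      (beta_planes mu d (2 * q) S ^+ 2 <= Ct%:E * iota_eucl mu d q S)%E &
      (Ct%:E * iota_eucl mu d q S <= Ct%:E * iota_planes mu d q S)%E].
Proof.
move=> d0 q1 C1.
have Ct0 : 0 < main_const d C q.
  have /andP[k0 _] := sel_kappa_itv d0 C1 d.
  have g0 : 0 < gram_const d C by rewrite divr_gt0 ?mulr_gt0 ?exprn_gt0.
  by apply: powR_gt0; rewrite !mulr_gt0 // powR_gt0.
exists (main_const d C q) => // n _ E regE c0 Delta /andP[c00 c01] Ds j Q Ej DQ mu S.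
have [_ QE] := dyadic_borel Ds Ej DQ.
have [x0 Ex0 ballQ] := dyadic_ball Ds Ej DQ.
have Qoo : (ediam Q < +oo)%E.
  by apply: le_lt_trans (dyadic_diam Ds Ej DQ) _; rewrite ltry.
have r0 : 0 < c0 * 2 ^ (- j) by rewrite mulr_gt0 // exprz_gt0.
(* For bounded [E], [2 ^ (- j) <= 2 ^ (- j0) <= ediam E], and [c0 < 1 < 2]. *)
have rE : ((c0 * 2 ^ (- j))%:E < 2%:E * ediam E)%E.
  case: Ej => [->|[j0 /andP[j0E _] j0j]]; first by rewrite gt0_muley ?ltry // lte_fin.
  have jE : (((2 : R) ^ (- j))%:E <= ediam E)%E.
    by apply: le_trans j0E; rewrite lee_fin ler_weXz2l ?lerN2 // ler1n.
  have j0' : 0 < (2 : R) ^ (- j) by rewrite exprz_gt0.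
  by apply: (lt_2ediam j0' jE); rewrite ltr_pM2r // (lt_trans c01) // ltr1n.
have [D [m [D0 m0 DS DE [mS muS mD SE]]]] := dilation2 d0 C1 regE QE Qoo Ex0 r0 rE ballQ.
split.
- rewrite lee_sqr ?beta_planes_ge0 //.
  exact: (beta_planes_le mS muS m0 q1).
- have i0 : (0 <= iota_eucl mu d q S)%E.
    by apply: le_ereal_inf_tmp => _ [f _ <-]; apply: poweR_ge0.
  case iE: (iota_eucl mu d q S) => [i| |]; last 2 first.
  + by rewrite gt0_muley ?leey // lte_fin.
  + by rewrite iE in i0.
  (* The infimum need not be attained: a map with distortion below [i + e / main_const d C q] costs
     an extra [e], which is arbitrary. *)
  apply/lee_addgt0Pr => e e0.
  have : (iota_eucl mu d q S < (i + e / main_const d C q)%:E)%E.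
    by rewrite iE lte_fin ltrDl divr_gt0.
  move=> /ereal_inf_lt [_ [f mf <-]] fs.
  have := beta_le_distortion d0 C1 regE D0 DS DE SE mS muS m0 mD q1 mf fs.
  by rewrite mulrDr mulrCA mulfV ?gt_eqF // mulr1 EFinD EFinM.
- by rewrite lee_wpmul2l ?lee_fin ?(ltW Ct0) // iota_eucl_le_planes.
Qed.
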